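(* Let $V$ be a simple vertex operator algebra, $G$ a finite group of automorphisms of $V$, and $M$ an irreducible $V$-module which is $G$-stable, i.e. $M\circ g\cong M$ for all $g\in G$. Let $\alpha_M$ be the 2-cocycle of the projective representation of $G$ on $M$, and let $\Lambda_{G,\alpha_M}$ be the set of irreducible characters of the twisted group algebra $\mathbb C^{\alpha_M}[G]$ (see context). For $\lambda\in\Lambda_{G,\alpha_M}$ let $M^\lambda$ be the $W_\lambda$-isotypic component of $M$ and $M_\lambda$ the multiplicity space of $W_\lambda$ in $M$. Then: 1) $M^\lambda$ is nonzero for every $\lambda\in\Lambda_{G,\alpha_M}$. 2) Each $M_\lambda$ is an irreducible $V^G$-module. 3) $M_\lambda$ and $M_\gamma$ are equivalent $V^G$-modules if and only if $\lambda=\gamma$. That is, $V^G$ and $\mathbb C^{\alpha_M}[G]$ form a dual pair on $M$.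
   Context: Vertex operator algebras $V=(V,Y,\mathbf 1,\omega)$ are over $\mathbb C$ in the usual sense (Borcherds, Frenkel–Lepowsky–Meurman): $V=\bigoplus_{n\in\mathbb Z}V_n$ with $\dim V_n<\infty$ and $V_n=0$ for $n$ sufficiently negative. $V$ is simple if it has no nontrivial ideals. An automorphism of $V$ is a linear automorphism $g$ with $g\mathbf 1=\mathbf 1$, $g\omega=\omega$, $gY(v,z)g^{-1}=Y(gv,z)$. $V^G=\{v\in V\mid gv=v\ \forall g\in G\}$ is a vertex operator subalgebra. A weak $V$-module $M$ is a vector space with a linear map $v\mapsto Y_M(v,z)=\sum_{n\in\mathbb Q}v_nz^{-n-1}$, $v_n\in\mathrm{End}\,M$, such that for $u,v\in V$, $w\in M$: $u_lw=0$ for $l\gg0$, $Y_M(\mathbf 1,z)=1$, and the Jacobi identity $z_0^{-1}\delta(\frac{z_1-z_2}{z_0})Y_M(u,z_1)Y_M(v,z_2)-z_0^{-1}\delta(\frac{z_2-z_1}{-z_0})Y_M(v,z_2)Y_M(u,z_1)=z_2^{-1}\delta(\frac{z_1-z_0}{z_2})Y_M(Y(u,z_0)v,z_2)$ holds, with $\delta(z)=\sum_{n\in\mathbb Z}z^n$. A $V$-module is a weak $V$-module $M=\bigoplus_{\lambda\in\mathbb C}M_\lambda$ with the $L(0)$-eigenspaces $M_\lambda$ (eigenvalue $\lambda$) finite dimensional and, for fixed $\lambda$, $M_{\lambda+n}=0$ for all sufficiently small integers $n$; here $Y_M(\omega,z)=\sum_n L(n)z^{-n-2}$. For $g\in G$,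 $M\circ g$ is the $V$-module equal to $M$ as a vector space with $Y_{M\circ g}(v,z)=Y_M(gv,z)$. For $g\in G$ fix a linear isomorphism $\phi(g):M\to M$ with $\phi(g)Y_M(v,z)\phi(g)^{-1}=Y_M(gv,z)$ for all $v\in V$, with $\phi(1)=\mathrm{id}$. By Schur's lemma $\phi(g)\phi(h)=\alpha_M(g,h)\phi(gh)$ with $\alpha_M(g,h)\in\mathbb C^*$, and $\alpha_M$ is a 2-cocycle on $G$. The twisted group algebra $\mathbb C^{\alpha_M}[G]$ has basis $\{\bar g\mid g\in G\}$ and product $\bar x\bar y=\alpha_M(x,y)\overline{xy}$; it acts on $M$ by $\bar g\mapsto\phi(g)$, and this action commutes with $V^G$. $W_\lambda$ denotes the simple $\mathbb C^{\alpha_M}[G]$-module with character $\lambda$; $M^\lambda$ is the sum of all $\mathbb C^{\alpha_M}[G]$-submodules of $M$ isomorphic to $W_\lambda$, so $M=\bigoplus_\lambda M^\lambda$ and $M^\lambda=W_\lambda\otimes M_\lambda$ with $M_\lambda=\mathrm{Hom}_{\mathbb C^{\alpha_M}[G]}(W_\lambda,M)$, on which $V^G$ acts through its action on $M$. ''Dual pair'' summarizes 1)–3): every simple module of the algebra occurs in $M$, its multiplicity space is an irreducible $V^G$-module, and different multiplicity spaces are inequivalent. *)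

(* Defs.v *)
(* The field of complex numbers is [R[i]] for
   [R : realType]. *)
From HB Require Import structures.
From mathcomp Require Import all_boot all_order all_algebra all_fingroup.
From mathcomp Require Import all_classical all_reals.
From mathcomp Require Import complex.

Set Implicit Arguments.
Unset Strict Implicit.
Unset Printing Implicit Defensive.

Import Order.TTheory GRing.Theory Num.Theory.
Local Open Scope classical_set_scope.
Local Open Scope ring_scope.
Local Open Scope complex_scope.

Section LinearAlgebra.
Context {R : realType}.
Implicit Types U E : lmodType R[i].

Definition linear_of U E (f : U -> E) (lf : linear f) : {linear U -> E} :=
  HB.pack f (GRing.isLinear.Build R[i] U E *:%R f lf).

Definition subspace E (S : set E) : Prop :=
  S 0 /\ forall (a : R[i]) (u v : E), S u -> S v -> S (a *: u + v).

Definition eigspace E (f : E -> E) (a : R[i]) : set E :=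
  [set v | f v = a *: v].

Definition finite_dim E (S : set E) : Prop :=
  exists n : nat, exists b : 'I_n -> E, (forall i, S (b i)) /\
    forall v, S v -> exists c : 'I_n -> R[i], v = \sum_i c i *: b i.

(* Every vector is in exactly one way a sum of vectors of the [S i], almost
   all of them zero. *)
Definition direct_sum_decomposition E (I : choiceType) (S : I -> set E) : Prop :=
  forall v : E, exists! x : I -> E,
    [/\ forall i, S i (x i), finite_set [set i | x i != 0]
      & v = \sum_(i \in [set: I]) x i].

Definition sum_of_subspaces E (F : set (set E)) : set E :=
  [set w | exists n : nat, exists x : 'I_n -> E,
     (forall i, exists2 N, F N & N (x i)) /\ w = \sum_i x i].

(* x(x - 1)...(x - i + 1) / i!, the coefficients of the expansion of
   (z1 + z2)^x in nonnegative powers of z2 *)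
Definition gbinom (x : R[i]) (i : nat) : R[i] :=
  (\prod_(j < i) (x - j%:R)) / i`!%:R.

End LinearAlgebra.

Section VertexOperatorAlgebras.
Variable R : realType.

(* [vmode u n] is the operator u_n in Y(u,z) = \sum_n u_n z^(-n-1). *)
Record vertex_data := VertexData {
  vsort :> lmodType R[i];
  vmode : vsort -> int -> {linear vsort -> vsort};
  vac : vsort;
  conf : vsort }.

(* L(n), where Y(omega,z) = \sum_n L(n) z^(-n-2) *)
Definition vir (V : vertex_data) (n : int) : {linear V -> V} :=
  vmode (conf V) (n + 1).

(* The coefficient of z0^(-l-1) z1^(-m-1) z2^(-n-1) in the Jacobi identity
   applied to w.  The sums are finite by [voa_truncation]. *)
Definition jacobi_identity (V : vertex_data) : Prop :=
  forall (u v w : V) (l m n : int),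
    \sum_(i \in [set: nat]) ((-1) ^+ i * gbinom l%:~R i) *:
        vmode u (m + l - i%:Z) (vmode v (n + i%:Z) w)
    - (-1) ^ l *: (\sum_(i \in [set: nat]) ((-1) ^+ i * gbinom l%:~R i) *:
        vmode v (n + l - i%:Z) (vmode u (m + i%:Z) w))
    = \sum_(i \in [set: nat]) gbinom m%:~R i *:
        vmode (vmode u (l + i%:Z) v) (m + n - i%:Z) w.

(* As L(0) acts on V_n as the scalar n and V is the direct sum of the V_n,
   the homogeneous space V_n is the L(0)-eigenspace of eigenvalue n. *)
Definition homogeneous (V : vertex_data) (n : int) : set V :=
  eigspace (vir V 0) n%:~R.

Record is_voa (V : vertex_data) : Prop := {
  voa_linear : forall (n : int) (w : V), linear (fun u : V => vmode u n w);
  voa_truncation : forall u w : V,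
    exists N : int, forall n : int, N <= n -> vmode u n w = 0;
  voa_vacuum : forall (n : int) (w : V),
    vmode (vac V) n w = if n == -1 then w else 0;
  voa_creation : forall u : V,
    vmode u (-1) (vac V) = u /\ forall n : int, 0 <= n -> vmode u n (vac V) = 0;
  voa_jacobi : jacobi_identity V;
  voa_virasoro : exists c : R[i], forall (m n : int) (w : V),
    vir V m (vir V n w) - vir V n (vir V m w) =
      (m - n)%:~R *: vir V (m + n) w +
      (if m + n == 0 then ((m ^+ 3 - m)%:~R / 12%:R * c) *: w else 0);
  voa_translation : forall (u w : V) (n : int),
    vmode (vir V (-1) u) n w = - (n%:~R *: vmode u (n - 1) w);
  voa_grading : direct_sum_decomposition (@homogeneous V);
  voa_finite_dim : forall n : int, finite_dim (@homogeneous V n);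
  voa_bounded_below : exists N : int,
    forall n : int, n < N -> @homogeneous V n = [set 0] }.

Definition is_ideal (V : vertex_data) (I : set V) : Prop :=
  subspace I /\
  forall (u v : V) (n : int), I v -> I (vmode u n v) /\ I (vmode v n u).

Definition simple_voa (V : vertex_data) : Prop :=
  forall I : set V, is_ideal I -> I = [set 0] \/ I = [set: V].

Record is_automorphism (V : vertex_data) (g : V -> V) : Prop := {
  aut_bijective : bijective g;
  aut_vac : g (vac V) = vac V;
  aut_conf : g (conf V) = conf V;
  aut_mode : forall (v : V) (n : int) (w : V),
    g (vmode v n w) = vmode (g v) n (g w) }.

(* A finite group of automorphisms of V: an injective homomorphism from the
   finite group [gT] to the automorphism group of V. *)
Record aut_group (V : vertex_data) (gT : finGroupType) := AutGroup {
  autg :> gT -> {linear V -> V};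
  autg_aut : forall g : gT, is_automorphism (autg g);
  autg_mul : forall (g h : gT) (v : V), autg (g * h)%g v = autg g (autg h v);
  autg_inj : forall g h : gT, (forall v : V, autg g v = autg h v) -> g = h }.

End VertexOperatorAlgebras.

Section Modules.
Variable R : realType.
Implicit Types V : vertex_data R.

(* [mmode v n] is the operator v_n in Y_M(v,z) = \sum_n v_n z^(-n-1), where n
   ranges over the rational numbers. *)
Record module_data V := ModuleData {
  msort :> lmodType R[i];
  mmode : V -> rat -> {linear msort -> msort} }.

(* The coefficient of z0^(-l-1) z1^(-m-1) z2^(-n-1) in the Jacobi identity
   applied to w.  The right-hand side of that identity only involves integral
   powers of z1. *)
Definition module_jacobi V (M : module_data V) : Prop :=
  forall (u v : V) (w : M) (l : int) (m n : rat),
    \sum_(i \in [set: nat]) ((-1) ^+ i * gbinom l%:~R i) *: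
        mmode M u (m + l%:~R - i%:R) (mmode M v (n + i%:R) w)
    - (-1) ^ l *: (\sum_(i \in [set: nat]) ((-1) ^+ i * gbinom l%:~R i) *:
        mmode M v (n + l%:~R - i%:R) (mmode M u (m + i%:R) w))
    = if m \is a Num.int then
        \sum_(i \in [set: nat]) gbinom (ratr m) i *:
          mmode M (vmode u (l + i%:Z) v) (m + n - i%:R) w
      else 0.

Record is_weak_module V (M : module_data V) : Prop := {
  wmod_linear : forall (n : rat) (w : M), linear (fun v : V => mmode M v n w);
  wmod_truncation : forall (u : V) (w : M),
    exists N : rat, forall l : rat, N <= l -> mmode M u l w = 0;
  wmod_vacuum : forall (n : rat) (w : M),
    mmode M (vac V) n w = if n == -1 then w else 0;
  wmod_jacobi : module_jacobi M }.

(* M_a is the eigenspace of L(0) = omega_1 of eigenvalue a. *)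
Definition weight_space V (M : module_data V) (a : R[i]) : set M :=
  eigspace (mmode M (conf V) 1) a.

Record is_module V (M : module_data V) : Prop := {
  mod_weak : is_weak_module M;
  mod_grading : direct_sum_decomposition (@weight_space V M);
  mod_finite_dim : forall a : R[i], finite_dim (@weight_space V M a);
  mod_bounded_below : forall a : R[i], exists N : int,
    forall n : int, n < N -> @weight_space V M (a + n%:~R) = [set 0] }.

Definition is_submodule V (M : module_data V) (S : set M) : Prop :=
  subspace S /\ forall (v : V) (n : rat) (w : M), S w -> S (mmode M v n w).

Definition irreducible_module V (M : module_data V) : Prop :=
  [/\ is_module M, exists w : M, w != 0
    & forall S : set M, is_submodule S -> S = [set 0] \/ S = [set: M]].

Definition equivalent_modules V (M N : module_data V) : Prop :=
  exists f : {linear M -> N}, bijective f /\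
    forall (v : V) (n : rat) (w : M), f (mmode M v n w) = mmode N v n (f w).

Definition twist_module V (M : module_data V) (g : V -> V) : module_data V :=
  @ModuleData V M (fun v n => mmode M (g v) n).

Definition G_stable V (gT : finGroupType) (G : aut_group V gT)
    (M : module_data V) : Prop :=
  forall g : gT, equivalent_modules (twist_module M (G g)) M.

End Modules.

Section FixedPoints.
Variables (R : realType) (V : vertex_data R) (gT : finGroupType).
Variable G : aut_group V gT.

Definition fixed_pred : {pred V} := fun v => [forall g : gT, G g v == v].

Lemma fixed_predP v : reflect (forall g : gT, G g v = v) (v \in fixed_pred).
Proof. exact: 'forall_eqP. Qed.

Lemma fixed_submod_closed : submod_closed fixed_pred.
Proof.
split=> [|a u v /fixed_predP fu /fixed_predP fv]; apply/fixed_predP => g.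
  by rewrite linear0.
by rewrite linearP fu fv.
Qed.

HB.instance Definition _ :=
  GRing.isSubmodClosed.Build R[i] V fixed_pred fixed_submod_closed.

Record fixed_space : predArgType :=
  FixedSpace { fixed_val : V; fixed_valP : fixed_val \in fixed_pred }.

HB.instance Definition _ := [isSub for fixed_val].
HB.instance Definition _ := [Choice of fixed_space by <:].
HB.instance Definition _ := [SubChoice_isSubLmodule of fixed_space by <:].

Lemma fixed_mode_subproof (u : fixed_space) (n : int) (v : fixed_space) :
  vmode (val u) n (val v) \in fixed_pred.
Proof.
apply/fixed_predP => g; rewrite (aut_mode (autg_aut G g)).
by rewrite (fixed_predP _ (valP u)) (fixed_predP _ (valP v)).
Qed.

Definition fixed_mode_fun (u : fixed_space) (n : int) (v : fixed_space) :
  fixed_space := FixedSpace (fixed_mode_subproof u n v).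

Lemma fixed_mode_linear u n : linear (fixed_mode_fun u n).
Proof. by move=> a v w; apply: val_inj; rewrite /= linearP. Qed.

Lemma fixed_vac_subproof : vac V \in fixed_pred.
Proof. by apply/fixed_predP => g; rewrite (aut_vac (autg_aut G g)). Qed.

Lemma fixed_conf_subproof : conf V \in fixed_pred.
Proof. by apply/fixed_predP => g; rewrite (aut_conf (autg_aut G g)). Qed.

Definition fixed_voa : vertex_data R :=
  @VertexData R fixed_space (fun u n => linear_of (fixed_mode_linear u n))
    (FixedSpace fixed_vac_subproof) (FixedSpace fixed_conf_subproof).

End FixedPoints.

Section TwistedGroupAlgebra.
Variables (R : realType) (gT : finGroupType).

(* The underlying space of the twisted group algebras of [gT]: the function a
   stands for \sum_g a(g) \bar g. *)
Definition tga := {ffun gT -> R[i]^o}.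

Definition tga_bar (g : gT) : tga := [ffun x => (x == g)%:R].

Variable alpha : gT -> gT -> R[i].

Definition tga_mul (a b : tga) : tga :=
  \sum_(x : gT) \sum_(y : gT) (a x * b y * alpha x y) *: tga_bar (x * y)%g.

Lemma tga_mul_bar x y :
  tga_mul (tga_bar x) (tga_bar y) = alpha x y *: tga_bar (x * y)%g.
Proof.
rewrite /tga_mul (bigD1 x) //= (bigD1 y) //= !ffunE !eqxx !mul1r.
rewrite !big1 ?addr0 // => [z /negPf zx|z /negPf zy].
  by rewrite big1 // => t _; rewrite ffunE zx !mul0r scale0r.
by rewrite ffunE zy mulr0 mul0r scale0r.
Qed.

(* A finite-dimensional space with an operator for each element of the
   twisted group algebra. *)
Record tga_rep := TgaRep {
  rsort :> vectType R[i];
  ract : tga -> 'End(rsort) }.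

(* The unit is \bar 1, since the cocycles considered here satisfy
   alpha(1,g) = alpha(g,1) = 1. *)
Definition is_tga_module (W : tga_rep) : Prop :=
  [/\ linear (ract W), ract W (tga_bar 1%g) = \1%VF
    & forall a b : tga, ract W (tga_mul a b) = (ract W a \o ract W b)%VF].

Definition simple_tga_module (W : tga_rep) : Prop :=
  [/\ is_tga_module W, ({:W} != 0)%VS
    & forall U : {vspace W}, (forall a : tga, (ract W a @: U <= U)%VS) ->
        U = 0%VS \/ U = {:W}%VS].

Definition character (W : tga_rep) (a : tga) : R[i] :=
  \tr (passmx.mxof (vbasis {:W}) (vbasis {:W}) (ract W a)).

(* \Lambda_{G,alpha} *)
Definition irreducible_characters : set (tga -> R[i]) :=
  [set lambda | exists2 W : tga_rep, simple_tga_module W & lambda = character W].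

End TwistedGroupAlgebra.

Section ProjectiveAction.
Variables (R : realType) (V : vertex_data R) (gT : finGroupType).
Variables (G : aut_group V gT) (M : module_data V).

Record intertwiners := Intertwiners {
  phi :> gT -> {linear M -> M};
  phi_bij : forall g : gT, bijective (phi g);
  phi_mode : forall (g : gT) (v : V) (n : rat) (w : M),
    phi g (mmode M v n w) = mmode M (G g v) n (phi g w);
  phi1 : forall w : M, phi 1%g w = w }.

Variable P : intertwiners.

(* alpha_M(g,h), the scalar with phi(g) phi(h) = alpha_M(g,h) phi(gh).  For M
   irreducible it exists and is unique by Schur's lemma. *)
Definition cocycle (g h : gT) : R[i] :=
  xget 0 [set a : R[i] | forall w : M, P g (P h w) = a *: P (g * h)%g w].

Definition tga_act (a : tga R gT) (w : M) : M := \sum_(g : gT) a g *: P g w.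

Definition equivariant (W : tga_rep R gT) (f : W -> M) : Prop :=
  forall (a : tga R gT) (x : W), f (ract W a x) = tga_act a (f x).

Definition submodules_iso (W : tga_rep R gT) : set (set M) :=
  [set N | exists f : {linear W -> M},
     [/\ injective f, equivariant f & N = range f]].

(* M^lambda, for W = W_lambda *)
Definition isotypic_component (W : tga_rep R gT) : set M :=
  sum_of_subspaces (submodules_iso W).

Section MultiplicitySpace.
Variable W : tga_rep R gT.

Definition hom_pred : {pred (W -> M)} :=
  fun f => `[< linear f /\ equivariant f >].

Lemma tga_act_linear a : linear (tga_act a).
Proof.
move=> c u v; rewrite /tga_act scaler_sumr -big_split /=.
apply: eq_bigr => g _.
by rewrite linearP scalerDr !scalerA mulrC.
Qed.

Lemma tga_act_mode a (v : fixed_space G) n w :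
  tga_act a (mmode M (val v) n w) = mmode M (val v) n (tga_act a w).
Proof.
rewrite /tga_act linear_sum /=; apply: eq_bigr => g _.
by rewrite linearZ /= phi_mode (fixed_predP _ _ (valP v)).
Qed.

Lemma hom_submod_closed : submod_closed hom_pred.
Proof.
split=> [|c f g /asboolP[lf ef] /asboolP[lg eg]]; apply/asboolP; split.
- by move=> a x y /=; rewrite scaler0 addr0.
- move=> a x /=; rewrite /tga_act big1 // => h _.
  by rewrite linear0 scaler0.
- move=> a x y; rewrite -[LHS]/(c *: f (a *: x + y) + g (a *: x + y)).
  rewrite -[(c *: f + g) x]/(c *: f x + g x) -[(c *: f + g) y]/(c *: f y + g y).
  rewrite lf lg !scalerDr !scalerA mulrC -!addrA.
  by congr (_ + _); rewrite addrCA.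
- move=> a x; rewrite -[LHS]/(c *: f (ract W a x) + g (ract W a x)) ef eg.
  by rewrite -tga_act_linear.
Qed.

HB.instance Definition _ :=
  GRing.isSubmodClosed.Build R[i] (W -> M) hom_pred hom_submod_closed.

Record hom_space : predArgType :=
  HomSpace { hom_val : W -> M; hom_valP : hom_val \in hom_pred }.

HB.instance Definition _ := [isSub for hom_val].
HB.instance Definition _ := [Choice of hom_space by <:].
HB.instance Definition _ := [SubChoice_isSubLmodule of hom_space by <:].

Lemma hom_mode_subproof (v : fixed_voa G) (n : rat) (f : hom_space) :
  (fun x : W => mmode M (val v) n (val f x)) \in hom_pred.
Proof.
have /asboolP[lf ef] := valP f; apply/asboolP; split.
  by move=> a x y; rewrite lf linearP.
by move=> a x; rewrite ef tga_act_mode.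
Qed.

Definition hom_mode_fun (v : fixed_voa G) (n : rat) (f : hom_space) :
  hom_space := HomSpace (hom_mode_subproof v n f).

Lemma hom_mode_linear v n : linear (hom_mode_fun v n).
Proof.
move=> a f g; apply: val_inj; apply/funext => x.
exact: (linearP (mmode M (val v) n) a (val f x) (val g x)).
Qed.

(* M_lambda = Hom(W_lambda, M) with the action of V^G through M *)
Definition multiplicity_space : module_data (fixed_voa G) :=
  @ModuleData R (fixed_voa G) hom_space
    (fun v n => linear_of (hom_mode_linear v n)).

End MultiplicitySpace.
End ProjectiveAction.

(* Main.v *)
Require Import Defs.
From HB Require Import structures.
From mathcomp Require Import all_boot all_order all_algebra all_fingroup.
From mathcomp Require Import all_classical all_reals.
From mathcomp Require Import complex.
From mathcomp Require Import zify ring lra.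

(* Let A be the algebra generated by the modes of V on M.  By Schur's lemma (an
   endomorphism of M preserves a finite-dimensional weight space) and Jacobson
   density, A is dense in End M; by associativity every element of A agrees, on
   finitely many given vectors, with a finite sum of modes of V.  Averaging
   over G turns a sum of modes that agrees with a G-equivariant map on a
   G-stable subspace into a sum of modes of V^G.  Hence V^G acts transitively
   on the nonzero vectors of Hom(W,M), and separates Hom(W,M) from Hom(W',M)
   unless W and W' are isomorphic.

   That W occurs in M amounts to the linear independence of the operators
   phi(g).  By weak commutativity the kernel of v (x) w |-> Y(v,z)w is stable
   under 1 (x) A, so by density and simplicity of V it is zero.  A relation
   sum_g c_g phi(g) = 0 gives sum_g c_g gv (x) phi(g)w = 0, and a functional l
   on V turns it into the relation sum_g c_g l(gv) phi(g) = 0: as in Artin's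
   theorem on characters, this shortens any relation with two terms. *)

Set Implicit Arguments.
Unset Strict Implicit.
Unset Printing Implicit Defensive.

Import Order.TTheory GRing.Theory Num.Theory.
Local Open Scope classical_set_scope.
Local Open Scope ring_scope.
Local Open Scope complex_scope.

(* [all_fingroup] also has a [ract]. *)
Local Notation ract := Defs.ract.

(** * Linear algebra and density *)

Section FiniteFamilies.
Variables (K : fieldType) (E : lmodType K) (I : finType).
Implicit Types (x y : I -> E) (J : {set I}).

Definition independent_on x J : Prop :=
  forall c : I -> K, \sum_(i in J) c i *: x i = 0 -> forall i, i \in J -> c i = 0.

Lemma independent_onS x J J' :
  J' \subset J -> independent_on x J -> independent_on x J'.
Proof.
move=> sJ indJ c c0 i iJ'.
have /(_ i (fintype.subsetP sJ i iJ')) :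
    forall i, i \in J -> (if i \in J' then c i else 0) = 0.
  apply: indJ; rewrite -[RHS]c0 [LHS](bigID (mem J')) /= [X in _ + X]big1 ?addr0.
    apply: eq_big => [k|k /andP[_ ->]//]; rewrite andbC.
    by case: (boolP (k \in J')) => // /(fintype.subsetP sJ).
  by move=> k /andP[_ /negPf->]; rewrite scale0r.
by rewrite iJ'.
Qed.

(** Take [J] maximal for inclusion. For [i] outside [J], a nontrivial relation on [i |: J] must
    involve [x i], which can then be solved for. *)
Lemma maximal_independent x :
  exists (J : {set I}) (m : I -> I -> K),
    independent_on x J /\ forall i, x i = \sum_(j in J) m i j *: x j.
Proof.
have ind0 : `[< independent_on x finset.set0 >] by apply/asboolP => c _ i; rewrite inE.
have [J /maxsetP[/asboolP indJ maxJ] _] :=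
  @maxset_exists _ (fun J => `[< independent_on x J >]) _ ind0.
suff /choice[m mE] : forall i, exists m : I -> K, x i = \sum_(j in J) m j *: x j.
  by exists J, m.
move=> i; case: (boolP (i \in J)) => [iJ|iJ].
  exists (fun j => (j == i)%:R); rewrite (bigD1 i) //= eqxx scale1r big1 ?addr0 //.
  by move=> j /andP[_ /negPf->]; rewrite scale0r.
have /existsNP[c /not_implyP[c0 /existsNP[k /not_implyP[kJ ck]]]] :
    ~ independent_on x (i |: J).
  move=> /asboolP/maxJ/(_ (finset.subsetUr _ _)) iJJ.
  by move: iJ; rewrite -iJJ !inE eqxx.
move: c0; rewrite big_setU1 //= => c0.
have ci : c i != 0.
  apply/eqP => ci; move: c0; rewrite ci scale0r add0r => /indJ cJ.
  by move: kJ; rewrite !inE => /predU1P[ki|/cJ //]; apply: ck; rewrite ki.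
exists (fun j => - (c i)^-1 * c j).
under eq_bigr do rewrite -scalerA.
rewrite -scaler_sumr; move/eqP: c0; rewrite addrC addr_eq0 => /eqP ->.
by rewrite scaleNr scalerN opprK scalerA mulVf ?scale1r.
Qed.

Lemma sum_coordinates x J (m : I -> I -> K) (c : I -> K) :
  (forall i, x i = \sum_(j in J) m i j *: x j) ->
  \sum_i c i *: x i = \sum_(j in J) (\sum_i c i * m i j) *: x j.
Proof.
move=> mE; rewrite -[RHS](eq_bigr _ (fun j _ => esym (scaler_suml _ _ _ _))).
rewrite exchange_big /=; apply: eq_bigr => i _.
by rewrite {1}mE scaler_sumr; apply: eq_bigr => j _; rewrite scalerA.
Qed.

(** Equivalently, [x i |-> y i] extends to a linear map on the span of [x]; a scalar-valued [y] is
    thus a functional on that span. *)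
Definition respects_relations (E' : lmodType K) x (y : I -> E') : Prop :=
  forall c : I -> K, \sum_i c i *: x i = 0 -> \sum_i c i *: y i = 0.

(** Some coordinate of the vector along a maximal independent subfamily is nonzero, and taking that
    coordinate is the functional. *)
Lemma separating_coordinates x (d : I -> K) :
  \sum_i d i *: x i != 0 ->
  exists l : I -> K^o, respects_relations x l /\ \sum_i d i * l i != 0.
Proof.
have [J [m [indJ mE]]] := maximal_independent x.
rewrite (sum_coordinates _ mE) => dx.
have [j jJ dj] : exists2 j, j \in J & \sum_i d i * m i j != 0.
  apply: contrapT => H; move/eqP: dx; apply.
  apply: big1 => j jJ; have [->|dj] := eqVneq (\sum_i d i * m i j) 0.
    by rewrite scale0r.
  by case: H; exists j.
exists (m^~ j); split=> // c.
by rewrite (sum_coordinates _ mE) => /indJ; apply.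
Qed.

End FiniteFamilies.

(** * The Jacobson density theorem *)

Section Density.
Variables (K : fieldType) (E : lmodType K) (A : (E -> E) -> Prop).
Hypothesis A_linear : forall a, A a -> linear a.
Hypothesis A_id : A id.
Hypothesis A_comb : forall c a b, A a -> A b -> A (fun w => c *: a w + b w).
Hypothesis A_comp : forall a b, A a -> A b -> A (fun w => a (b w)).
Hypothesis A_irr : forall x y : E, x != 0 -> exists2 a, A a & a x = y.
Hypothesis A_schur : forall T : E -> E, linear T ->
  (forall a x, A a -> T (a x) = a (T x)) -> exists c, forall x, T x = c *: x.

Let A0 : A (fun=> 0).
Proof.
have -> : (fun=> 0) = (fun w : E => (-1) *: id w + id w).
  by apply: funext => w; rewrite scaleN1r addNr.
exact: A_comb.
Qed.

Let a0 a : A a -> a 0 = 0.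
Proof. by move=> /A_linear la; have := la (-1) 0 0; rewrite scaler0 add0r scaleN1r addNr. Qed.

Let A_sum (I : finType) (P : pred I) (a : I -> E -> E) :
  (forall i, P i -> A (a i)) -> A (fun w => \sum_(i | P i) a i w).
Proof.
move=> Aa; suff H : forall s : seq I, A (fun w => \sum_(i <- s | P i) a i w) by exact: H.
elim=> [|i s IHs].
  rewrite (_ : (fun w => _) = fun=> 0); first exact: A0.
  by apply: funext => w; rewrite big_nil.
have [Pi|Pi] := boolP (P i).
  have -> : (fun w => \sum_(i <- i :: s | P i) a i w) =
      (fun w => 1 *: a i w + \sum_(i <- s | P i) a i w).
    by apply: funext => w; rewrite big_cons Pi scale1r.
  by apply: A_comb => //; apply: Aa.
rewrite (_ : (fun w => _) = fun w => \sum_(i <- s | P i) a i w) //.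
by apply: funext => w; rewrite big_cons (negPf Pi).
Qed.

Let density_rec (I : finType) (x : I -> E) n : forall J : {set I},
  #|J| = n -> independent_on x J ->
  forall y : I -> E, exists2 a, A a & forall j, j \in J -> a (x j) = y j.
Proof.
elim: n => [|n IHn] J.
  by move/eqP; rewrite cards_eq0 => /eqP-> _ y; exists id => // j; rewrite inE.
move=> cJ indJ.
have /card_gt0P[k kJ] : (0 < #|J|)%N by rewrite cJ.
pose J' := J :\ k.
have cJ' : #|J'| = n by move: cJ; rewrite (cardsD1 k) kJ => -[].
have indJ' : independent_on x J' by apply: independent_onS indJ; apply: finset.subsetDl.
have {IHn}IH := IHn J' cJ' indJ'.
(* It suffices to kill every [x j] with [j] in [J'] but not [x k]: transitivity then corrects, at
   [x k] only, an element [b] that is already right on [J']. *)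
suff [a Aa [ak aJ]] : exists2 a, A a & a (x k) != 0 /\ forall j, j \in J' -> a (x j) = 0.
  move=> y; have [b Ab bJ] := IH y; have [e Ae ek] := A_irr (y k - b (x k)) ak.
  exists (fun w => 1 *: e (a w) + b w); first by apply: A_comb => //; apply: A_comp.
  move=> j jJ; rewrite scale1r; have [->|jk] := eqVneq j k; first by rewrite ek subrK.
  have jJ' : j \in J' by rewrite !inE jk.
  by rewrite aJ // bJ // a0 // add0r.
apply: contrapT => H.
have kill a : A a -> (forall j, j \in J' -> a (x j) = 0) -> a (x k) = 0.
  move=> Aa aJ; apply/eqP/negPn/negP => ak; apply: H; exists a => //.
have agree a b : A a -> A b -> (forall j, j \in J' -> a (x j) = b (x j)) ->
    a (x k) = b (x k).
  move=> Aa Ab ab; apply/eqP; rewrite -subr_eq0 addrC -scaleN1r; apply/eqP.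
  apply: (kill (fun w => (-1) *: b w + a w)); first exact: A_comb.
  by move=> j jJ; rewrite ab // scaleN1r addNr.
(* By induction there is [e (j, w)] in [A] that sends [x j] to [w] and the other [x i] with [i] in
   [J'] to 0. *)
pose dl (j : I) (w : E) := fun i : I => if i == j then w else 0 : E.
have /choice[e eP] : forall jw : I * E, exists a, A a /\
    forall i, i \in J' -> a (x i) = dl jw.1 jw.2 i.
  by move=> [j w]; have [a Aa aP] := IH (dl j w); exists a.
have Ae jw : A (e jw) by have [] := eP jw.
have eE j w i : i \in J' -> e (j, w) (x i) = dl j w i by have [_] := eP (j, w); apply.
(* If the annihilator of the [x j], [j \in J'], killed [x k], then mapping
   [a (x j)] to [a (x k)] for [a] killing the other [x i] would be a
   well-defined endomorphism, hence a scalar [c j]. *)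
have /choice[c cP] : forall j, exists c, j \in J' -> forall w, e (j, w) (x k) = c *: w.
  move=> j; case: (boolP (j \in J')) => [jJ|]; last by exists 0.
  have [||c cE] := A_schur (T := fun w => e (j, w) (x k)); last by exists c.
    move=> r u v; apply: (agree _ (fun w => r *: e (j, u) w + e (j, v) w)) => //.
      exact: A_comb.
    move=> i iJ; rewrite !eE // /dl; case: ifP => // _.
    by rewrite scaler0 addr0.
  move=> a w Aa; apply: (agree _ (fun v => a (e (j, w) v))) => //.
    exact: A_comp.
  by move=> i iJ; rewrite !eE // /dl; case: ifP => // _; rewrite a0.
(* The identity and the sum of the [e (j, x j)] agree on [J'], hence at [x k]; the resulting
   relation contradicts the independence of [x] on [J]. *)
have xk : x k = \sum_(j in J') c j *: x j.
  rewrite (agree id (fun w => \sum_(j in J') e (j, x j) w)) //.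
  - by apply: eq_bigr => j jJ; rewrite cP.
  - by apply: A_sum.
  move=> j jJ /=; rewrite (bigD1 j) //= eE // /dl eqxx big1 ?addr0 // => i /andP[iJ ij].
  by rewrite eE // /dl eq_sym (negPf ij).
have /(_ k kJ) : forall i, i \in J -> (if i == k then -1 else c i) = 0.
  apply: indJ; rewrite (big_setD1 k) //= eqxx scaleN1r.
  apply/eqP; rewrite addrC subr_eq0 xk; apply/eqP/eq_bigr => j.
  by rewrite !inE => /andP[/negPf-> _].
by rewrite eqxx => /eqP; rewrite oppr_eq0 oner_eq0.
Qed.

(** Prescribe [y] on a maximal independent subfamily; the relations expressing the other [x i] in
    it, which [y] respects, force the remaining values. *)
Theorem jacobson_density (I : finType) (x y : I -> E) :
  respects_relations x y -> exists2 a, A a & forall i, a (x i) = y i.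
Proof.
move=> xy; have [J [m [indJ mE]]] := maximal_independent x.
have [a Aa aJ] := density_rec erefl indJ y.
exists a => // i.
pose c j : K := (j == i)%:R - (if j \in J then m i j else 0).
have sumc (z : I -> E) : \sum_j c j *: z j = z i - \sum_(j in J) m i j *: z j.
  under eq_bigr do rewrite scalerBl.
  rewrite sumrB; congr (_ - _).
    rewrite (bigD1 i) //= eqxx scale1r big1 ?addr0 // => j /negPf->.
    by rewrite scale0r.
  by rewrite [RHS]big_mkcond /=; apply: eq_bigr => j _; case: ifP => // _; rewrite scale0r.
have /xy/eqP : \sum_j c j *: x j = 0 by rewrite sumc -mE subrr.
rewrite sumc subr_eq0 => /eqP->; rewrite mE.
pose al : {linear E -> E} := HB.pack a (GRing.isLinear.Build K E E *:%R a (A_linear Aa)).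
rewrite -[a]/(al : E -> E) linear_sum; apply: eq_bigr => j jJ.
by rewrite linearZ /= aJ.
Qed.

End Density.

(** * Consequences of the Jacobi identity *)

(** The sums over [nat] in the Jacobi identity are sums of finite support, so each use of that
    identity first bounds the nonzero terms. *)
Lemma natsum_trunc (E : nmodType) (F : nat -> E) N :
  (forall i, (N <= i)%N -> F i = 0) ->
  \sum_(i \in [set: nat]) F i = \sum_(i < N) F i.
Proof.
move=> F0; rewrite fsbig_ord; apply/esym/fsbig_widen => // i [_ /negP].
by rewrite -leqNgt => /F0.
Qed.

Lemma gbinom0 (R : realType) (x : R[i]) : gbinom x 0 = 1.
Proof. by rewrite /gbinom big_ord0 fact0 divr1. Qed.

Section Modes.
Variables (R : realType) (V : vertex_data R) (M : module_data V).
Hypothesis hV : is_voa V.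
Hypothesis hM : is_weak_module M.

(** No coefficients are recorded: modes are linear in the vector of [V], which absorbs scalars. *)
Definition mode_sum (s : seq (V * rat)) (w : M) : M :=
  \sum_(p <- s) mmode M p.1 p.2 w.

Lemma mmodeDl u v n (w : M) : mmode M (u + v) n w = mmode M u n w + mmode M v n w.
Proof. by have := wmod_linear hM n w 1 u v; rewrite !scale1r. Qed.

Lemma mmode0l n (w : M) : mmode M 0 n w = 0.
Proof. by apply: (addrI (mmode M 0 n w)); rewrite -mmodeDl !addr0. Qed.

Lemma mmodeZl a u n (w : M) : mmode M (a *: u) n w = a *: mmode M u n w.
Proof. by have := wmod_linear hM n w a u 0; rewrite mmode0l !addr0. Qed.

Lemma mmode_suml (I : Type) (s : seq I) (P : pred I) (u : I -> V) n (w : M) :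
  mmode M (\sum_(i <- s | P i) u i) n w = \sum_(i <- s | P i) mmode M (u i) n w.
Proof.
apply: (big_morph (fun u => mmode M u n w)) => [u1 u2|]; last exact: mmode0l.
exact: mmodeDl.
Qed.

Lemma mmode_trunc (I J : finType) (u : I -> V) (w : J -> M) :
  exists K : nat, forall i j (n : rat), K%:R <= n -> mmode M (u i) n (w j) = 0.
Proof.
have /choice[N NP] : forall p : I * J, exists N : rat,
    forall n : rat, N <= n -> mmode M (u p.1) n (w p.2) = 0.
  by move=> p; apply: wmod_truncation.
exists (\max_p Num.bound `|N p|) => i j n le_n.
apply: (NP (i, j)); apply: le_trans le_n; apply: le_trans (ler_norm _) _.
apply: le_trans (ltW (archi_boundP (normr_ge0 _))) _.
by rewrite ler_nat (leq_bigmax (F := fun p => Num.bound `|N p|)).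
Qed.

Lemma vmode_trunc (I : finType) (u v : I -> V) :
  exists K : nat, forall i (n : int), K%:Z <= n -> vmode (u i) n (v i) = 0.
Proof.
have /choice[N NP] : forall i, exists N : int, forall n : int, N <= n -> vmode (u i) n (v i) = 0.
  by move=> i; apply: voa_truncation.
exists (\max_i `|N i|%N) => i n le_n.
apply: NP; apply: le_trans le_n.
have := leq_bigmax (F := fun i => `|N i|%N) i; lia.
Qed.

(** Take the Jacobi identity for [u] and the vacuum with [l], [m], [n] equal to [-1], [n + 1], [-1]:
    the left-hand side is [u_n w], and the right-hand side is 0 because [n + 1] is not integral. *)
Lemma mmode_nonint u n (w : M) : n \isn't a Num.int -> mmode M u n w = 0.
Proof.
move=> nint; have := wmod_jacobi hM u (vac V) w (-1) (n + 1) (-1).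
rewrite (_ : (n + 1 \is a Num.int) = false); last first.
  by apply: contraNF nint => n1; rewrite -(addrK 1 n) rpredB.
rewrite (@natsum_trunc _ _ 1); last first.
  move=> i i1; rewrite (wmod_vacuum hM) ifF ?linear0 ?scaler0 //.
  by rewrite -{2}[-1]addr0 (inj_eq (addrI _)) pnatr_eq0; case: i i1.
rewrite (@natsum_trunc _ _ 0); last first.
  move=> i i1; rewrite (wmod_vacuum hM) ifF ?scaler0 //.
  rewrite -addrA -{2}[-1]addr0 (inj_eq (addrI _)) lt_eqF // mulrN1z.
  by have := ler0n rat i; lra.
rewrite big_ord1 big_ord0 /= scaler0 !subr0 gbinom0 mulr1 expr0 scale1r.
by rewrite (wmod_vacuum hM) /= mulrN1z addrK.
Qed.

Lemma exists_shift (K : nat) (n : rat) : exists T : nat, K%:R <= n + T%:R.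
Proof.
exists (K + Num.bound `|n|)%N; rewrite natrD.
by have := ltW (archi_boundP (normr_ge0 n)); have := ler_norm (- n); rewrite normrN; lra.
Qed.

(** A single list of modes serves all indices [i], since density concerns finitely many vectors
    simultaneously. *)
Definition in_mode_span (I : finType) (x y : I -> M) : Prop :=
  exists s, forall i, y i = mode_sum s (x i).

Lemma in_mode_span_mode (I : finType) (x : I -> M) u n :
  in_mode_span x (fun i => mmode M u n (x i)).
Proof. by exists [:: (u, n)] => i; rewrite /mode_sum big_seq1. Qed.

Lemma in_mode_span0 (I : finType) (x y : I -> M) :
  (forall i, y i = 0) -> in_mode_span x y.
Proof. by move=> y0; exists [::] => i; rewrite /mode_sum big_nil. Qed.

Lemma in_mode_spanP (I : finType) (x y z : I -> M) c :
  in_mode_span x y -> in_mode_span x z -> in_mode_span x (fun i => c *: y i + z i).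
Proof.
move=> [s sP] [t tP]; exists ([seq (c *: p.1, p.2) | p <- s] ++ t) => i.
rewrite sP tP /mode_sum big_cat big_map /=; congr (_ + _).
by rewrite scaler_sumr; apply: eq_bigr => p _; rewrite mmodeZl.
Qed.

Lemma in_mode_span_ext (I : finType) (x y z : I -> M) :
  (forall i, y i = z i) -> in_mode_span x y -> in_mode_span x z.
Proof. by move=> yz [s sP]; exists s => i; rewrite -yz. Qed.

Lemma in_mode_span_sum (I J : finType) (x : I -> M) (c : J -> R[i]) (y : J -> I -> M) :
  (forall j, in_mode_span x (y j)) -> in_mode_span x (fun i => \sum_j c j *: y j i).
Proof.
move=> xy.
suff H : forall s : seq J, in_mode_span x (fun i => \sum_(j <- s) c j *: y j i) by exact: H.
elim=> [|j s IHs]; first by apply: in_mode_span0 => i; rewrite big_nil.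
apply: in_mode_span_ext (in_mode_spanP (c j) (xy j) IHs) => i.
by rewrite big_cons.
Qed.

(* Associativity, by downward induction on [q]: for [m] large the second sum
   of the Jacobi identity vanishes, and its other terms [u_(p-i) v_(q+i)] have
   a larger second index. *)
Lemma in_mode_span_mode2 (I : finType) (x : I -> M) u v p q :
  in_mode_span x (fun i => mmode M u p (mmode M v q (x i))).
Proof.
have [/intrP[r ->]|pn] := boolP (p \is a Num.int); last first.
  by apply: in_mode_span0 => i; rewrite mmode_nonint.
have [K0 KP0] := mmode_trunc (fun b : bool => if b then u else v) x.
have [k le_k] := exists_shift K0 q.
elim: k r q le_k => [|k IHk] r q le_k.
  apply: in_mode_span0 => i.
  by rewrite (KP0 false) ?linear0 //; rewrite addr0 in le_k.
have [L LP] := vmode_trunc (fun _ : 'I_1 => u) (fun _ => v).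
(* The Jacobi identity is used with [m = K0], so that [m + l = r] and the first term of its first
   sum is [u_r v_q]. From [L'] on, the vectors [u_(l+j) v] vanish. *)
pose l : int := r - K0%:Z.
pose L' := (L + `|l|)%N.
have IH (j : 'I_k) : in_mode_span x
    (fun i => mmode M u ((r - j.+1%:Z)%:~R) (mmode M v (q + j.+1%:R) (x i))).
  apply: IHk; apply: le_trans le_k _.
  by have := ler0n rat j; rewrite !mulrSr; lra.
have S1 := in_mode_span_sum (fun j : 'I_k => (-1) ^+ j.+1 * gbinom l%:~R j.+1) IH.
have S2 := in_mode_span_sum (fun j : 'I_L' => gbinom (ratr K0%:R) j)
  (fun j => in_mode_span_mode x (vmode u (l + j%:Z) v) (K0%:R + q - j%:R)).
apply: in_mode_span_ext (in_mode_spanP (-1) S1 S2) => i.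
have := wmod_jacobi hM u v (x i) l K0%:R q.
rewrite natr_int (@natsum_trunc _ _ k.+1); last first.
  move=> j kj; rewrite (KP0 false) ?linear0 ?scaler0 //.
  by apply: le_trans le_k _; rewrite lerD2l ler_nat.
rewrite (@natsum_trunc _ _ 0); last first.
  by move=> j _; rewrite (KP0 true) ?linear0 ?scaler0 // lerDl ler0n.
rewrite (@natsum_trunc _ _ L'); last first.
  move=> j Lj; rewrite (LP ord0) ?mmode0l ?scaler0 //; rewrite /L' in Lj; lia.
rewrite big_ord0 scaler0 subr0 big_ord_recl /= => <-.
have idx (j : nat) : K0%:R + l%:~R - j%:R = (r - j%:Z)%:~R :> rat.
  by rewrite /l !rmorphB /= !pmulrn [X in X - _]addrC subrK.
rewrite gbinom0 mulr1 expr0 scale1r scaleN1r addrCA -[RHS]addr0.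
congr (_ + _); first by move: (idx 0%N); rewrite !subr0 ?addr0 => ->.
apply/eqP; rewrite addrC subr_eq0; apply/eqP/eq_bigr => j _.
by rewrite /bump /= add1n idx.
Qed.

Lemma in_mode_span_comp (I : finType) (x y z : I -> M) :
  in_mode_span x y -> in_mode_span y z -> in_mode_span x z.
Proof.
move=> [s sP] [t tP].
apply: in_mode_span_ext (fun i => esym (tP i)) _.
suff H v n : in_mode_span x (fun i => mmode M v n (y i)).
  elim: t {z tP} => [|p t IHt]; first by apply: in_mode_span0 => i; rewrite /mode_sum big_nil.
  apply: in_mode_span_ext (in_mode_spanP 1 (H p.1 p.2) IHt) => i.
  by rewrite scale1r /mode_sum big_cons.
elim: s y sP {tP} => [|p s IHs] y sP.
  by apply: in_mode_span0 => i; rewrite sP /mode_sum big_nil linear0.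
have IH := IHs _ (fun i => erefl).
apply: in_mode_span_ext (in_mode_spanP 1 (in_mode_span_mode2 x v p.1 n p.2) IH) => i.
by rewrite scale1r sP /mode_sum big_cons linearD.
Qed.

(** Closed under composition by construction, as density requires; associativity leads back to mode
    sums in [mode_algebra_span]. *)
Inductive mode_algebra : (M -> M) -> Prop :=
| mode_algebra_mode v n : mode_algebra (mmode M v n)
| mode_algebra_comb c a b : mode_algebra a -> mode_algebra b ->
    mode_algebra (fun w => c *: a w + b w)
| mode_algebra_comp a b : mode_algebra a -> mode_algebra b ->
    mode_algebra (fun w => a (b w)).

Lemma mode_algebra_linear a : mode_algebra a -> linear a.
Proof.
elim=> [v n|c {}a b _ la _ lb|{}a b _ la _ lb] k x y; first exact: linearP.
  by rewrite la lb scalerDr [c *: (k *: _)]scalerA mulrC -scalerA addrACA -scalerDr.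
by rewrite lb la.
Qed.

Lemma mode_algebra_id : mode_algebra id.
Proof.
have -> : id = mmode M (vac V) (-1) by apply: funext => w; rewrite (wmod_vacuum hM) eqxx.
exact: mode_algebra_mode.
Qed.

Lemma mode_algebra_span (I : finType) (x : I -> M) a :
  mode_algebra a -> in_mode_span x (fun i => a (x i)).
Proof.
move=> Aa; elim: Aa x => [v n|c {}a b _ IHa _ IHb|{}a b _ IHa _ IHb] x.
- exact: in_mode_span_mode.
- exact: in_mode_spanP.
- exact: in_mode_span_comp (IHb x) (IHa _).
Qed.

(** The sum of the tensors [v i (x) w i] lies in the kernel of [v (x) w |-> Y(v,z)w]. *)
Definition killed (I : finType) (v : I -> V) (w : I -> M) : Prop :=
  forall n, \sum_i mmode M (v i) n (w i) = 0.

(* Weak commutativity: for [l] large the right-hand side of the Jacobi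
   identity vanishes. *)
Lemma killed_mode (I : finType) (v : I -> V) (w : I -> M) u q :
  killed v w -> killed v (fun i => mmode M u q (w i)).
Proof.
move=> vw.
have [K KP] := mmode_trunc (fun o : option I => if o is Some i then v i else u) w.
have [L LP] := vmode_trunc (fun _ : I => u) v.
have [k le_k] := exists_shift K q.
elim: k q le_k => [|k IHk] q le_k n.
  by apply: big1 => i _; rewrite (KP None) ?linear0 //; rewrite addr0 in le_k.
have [T TP] := exists_shift K (n - L%:R).
(* The third index is taken to be [n - L], so that with [l = L] the modes of [v i] on the right run
   down from [n]. *)
have jac i : \sum_(j < T) ((-1) ^+ j * gbinom (L%:Z)%:~R j) *:
        mmode M u (q + (L%:Z)%:~R - j%:R) (mmode M (v i) (n - L%:R + j%:R) (w i))
    = (-1) ^ (L%:Z) *: \sum_(j < k.+1) ((-1) ^+ j * gbinom (L%:Z)%:~R j) *: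
        mmode M (v i) (n - j%:R) (mmode M u (q + j%:R) (w i)).
  apply/eqP; rewrite -subr_eq0; apply/eqP.
  have := wmod_jacobi hM u (v i) (w i) L q (n - L%:R).
  rewrite (@natsum_trunc _ _ T); last first.
    move=> j kj; rewrite (KP (Some i)) ?linear0 ?scaler0 //.
    by apply: le_trans TP _; rewrite lerD2l ler_nat.
  rewrite (@natsum_trunc _ _ k.+1); last first.
    move=> j kj; rewrite (KP None) ?linear0 ?scaler0 //.
    by apply: le_trans le_k _; rewrite lerD2l ler_nat.
  rewrite (@natsum_trunc _ _ 0); last first.
    by move=> j _; rewrite (LP i) ?mmode0l ?scaler0 //; lia.
  by rewrite big_ord0 subrK; case: ifP.
(* Summed over [i], the left-hand sides of [jac] are modes of [u] applied to sums that vanish by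
   [vw]. On the right, induction removes every term but [j = 0], which is the goal. *)
have : \sum_i (-1) ^ (L%:Z) *: \sum_(j < k.+1) ((-1) ^+ j * gbinom (L%:Z)%:~R j) *:
        mmode M (v i) (n - j%:R) (mmode M u (q + j%:R) (w i)) = 0.
  rewrite -(eq_bigr _ (fun i _ => jac i)) exchange_big /= big1 // => j _.
  by rewrite -scaler_sumr -linear_sum vw linear0 scaler0.
rewrite -scaler_sumr => /eqP; rewrite scaler_eq0 expfz_eq0 oppr_eq0 oner_eq0 andbF /=.
rewrite exchange_big big_ord_recl /= [X in _ + X]big1 ?addr0.
  by rewrite gbinom0 mulr1 expr0 -scaler_sumr scale1r => /eqP.
move=> j _; rewrite -scaler_sumr IHk ?scaler0 //.
by apply: le_trans le_k _; have := ler0n rat j; rewrite /bump /= add1n !mulrSr; lra.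
Qed.

Lemma killed_algebra (I : finType) (v : I -> V) a (w : I -> M) :
  mode_algebra a -> killed v w -> killed v (fun i => a (w i)).
Proof.
move=> Aa; elim: Aa w => [u n|c {}a b _ IHa _ IHb|{}a b _ IHa _ IHb] w vw.
- exact: killed_mode.
- move=> n; under eq_bigr do rewrite linearP.
  by rewrite big_split -scaler_sumr /= (IHa _ vw) (IHb _ vw) scaler0 addr0.
- exact: IHa (IHb _ vw).
Qed.

End Modes.

(** * Irreducible modules *)

(** The spanning family [b] may be dependent, so [T] is lifted to a matrix [A] on coordinates. The
    characteristic polynomial splits, and by Cayley-Hamilton its factors [A - r], applied in turn to
    coordinates of [x], reach a vector representing 0; the last one not representing 0 gives an
    eigenvector. *)
Lemma stable_eigenvector (R : realType) (E : lmodType R[i]) (T : {linear E -> E}) (S : set E) :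
  finite_dim S -> (forall x, S x -> S (T x)) -> (exists2 x, S x & x != 0) ->
  exists (r : R[i]) (y : E), y != 0 /\ T y = r *: y.
Proof.
move=> [n [b [Sb Sspan]]] ST [x /Sspan[c xE] x0].
case: n b Sb Sspan c xE => [|n] b Sb Sspan c xE.
  by move: x0; rewrite xE big_ord0 eqxx.
have /choice[A' A'E] : forall i, exists a : 'I_n.+1 -> R[i], T (b i) = \sum_j a j *: b j.
  by move=> i; apply/Sspan/ST.
pose A : 'M[R[i]]_n.+1 := \matrix_(i, j) A' i j.
pose L (z : 'rV[R[i]]_n.+1) := \sum_i z 0 i *: b i.
have TL z : T (L z) = L (z *m A).
  rewrite linear_sum /L.
  under [RHS]eq_bigr do rewrite mxE scaler_suml.
  rewrite exchange_big; apply: eq_bigr => i _ /=; rewrite linearZ /= A'E scaler_sumr.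
  by apply: eq_bigr => j _; rewrite !mxE scalerA.
have LB y z (a : R[i]) : L (y - a *: z) = L y - a *: L z.
  rewrite /L scaler_sumr -sumrB; apply: eq_bigr => i _.
  by rewrite !mxE scalerBl scalerA.
suff H (s : seq R[i]) z : L z != 0 ->
    L (z *m horner_mx A (\prod_(r <- s) ('X - r%:P))) = 0 ->
    exists r y, L y != 0 /\ T (L y) = r *: L y.
  have [s sE] := closed_field_poly_normal (char_poly A).
  have [||r [y [y0 yE]]] := H s (\row_i c i); last by exists r, (L y).
    by rewrite (_ : L _ = x) // xE; apply: eq_bigr => i _; rewrite mxE.
  have := Cayley_Hamilton A; rewrite sE (monicP (char_poly_monic A)) scale1r => ->.
  by rewrite mulmx0 /L big1 // => i _; rewrite mxE scale0r.
elim: s z => [|r s IHs] z z0.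
  by rewrite big_nil rmorph1 mulmx1 => z1; rewrite z1 eqxx in z0.
rewrite big_cons rmorphM /= rmorphB /= horner_mx_X horner_mx_C -mulmxE mulmxA => zs.
have zE : L (z *m (A - r%:M)) = T (L z) - r *: L z.
  by rewrite mulmxBr mul_mx_scalar LB TL.
have [z1|z1] := eqVneq (L (z *m (A - r%:M))) 0; last exact: IHs z1 zs.
by exists r, z; split=> //; apply/eqP; rewrite -subr_eq0 -zE z1.
Qed.

Section IrreducibleModules.
Variables (R : realType) (V : vertex_data R) (M : module_data V).
Hypothesis hV : is_voa V.
Hypothesis hM : irreducible_module M.

Let hMm : is_module M := let: And3 h _ _ := hM in h.
Let hMw : is_weak_module M := mod_weak hMm.

Lemma weight_space_nonzero (w : M) :
  w != 0 -> exists a, exists2 x, @weight_space R V M a x & x != 0.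
Proof.
move=> w0; apply: contrapT => H.
have [x [[xS _ xE] _]] := mod_grading hMm w.
move/eqP: w0; apply; rewrite xE fsbig1 // => a _.
by apply/eqP/negPn/negP => xa; apply: H; exists a, (x a).
Qed.

(** Commuting with [L(0)], [T] preserves a nonzero finite-dimensional weight space and has an
    eigenvector there; the corresponding eigenspace is a nonzero submodule, hence all of [M]. *)
Lemma schur (T : M -> M) : linear T ->
  (forall v n w, T (mmode M v n w) = mmode M v n (T w)) ->
  exists c, forall w, T w = c *: w.
Proof.
move=> lT comT; have [_ [w w0] irrM] := hM.
pose Tl := linear_of lT.
have [a [x ax x0]] := weight_space_nonzero w0.
have [||c [y [y0 yE]]] := @stable_eigenvector _ _ Tl _ (mod_finite_dim hMm a).
- move=> z; rewrite /weight_space /eigspace /= => zE.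
  by rewrite -comT zE -[T _]/(Tl _) linearZ.
- by exists x.
exists c; have [||] := irrM [set z | T z = c *: z].
- split; first split => /=.
  + by rewrite -[T _]/(Tl _) linear0 scaler0.
  + by move=> k u v /= uE vE; rewrite lT uE vE scalerDr !scalerA mulrC.
  + by move=> v n z /= zE; rewrite comT zE linearZ.
- move=> ker0; have : [set z | T z = c *: z] y by [].
  by rewrite ker0 /= => y1; rewrite y1 eqxx in y0.
- by move=> kerT z; have : [set z | T z = c *: z] z by rewrite kerT.
Qed.

Lemma schur_intertwiners (k : V -> V) (T1 T2 : {linear M -> M}) : bijective T2 ->
  (forall v n w, T1 (mmode M v n w) = mmode M (k v) n (T1 w)) ->
  (forall v n w, T2 (mmode M v n w) = mmode M (k v) n (T2 w)) ->
  exists c, forall w, T1 w = c *: T2 w.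
Proof.
move=> [U T2K UK] T1E T2E.
have lU := can2_linear T2K UK.
have [||c cE] := @schur (U \o T1).
- by move=> a x y /=; rewrite linearP lU.
- by move=> v n w /=; apply: (can_inj T2K); rewrite UK T2E UK T1E.
by exists c => w; rewrite -[T1 w]UK -[U (T1 w)]/((U \o T1) w) cE linearZ.
Qed.

Lemma mode_algebra_transitive (x y : M) :
  x != 0 -> exists2 a, mode_algebra a & a x = y.
Proof.
move=> x0; have [_ _ irrM] := hM.
have idA := mode_algebra_id hMw.
have [||] := irrM [set z | exists2 a, mode_algebra a & a x = z].
- split; first split => /=.
  + exists (fun w => (-1) *: id w + id w); last by rewrite scaleN1r addNr.
    exact: mode_algebra_comb.
  + move=> c _ _ [a Aa <-] [b Ab <-]; exists (fun w => c *: a w + b w) => //.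
    exact: mode_algebra_comb.
  + move=> v n _ /= [a Aa <-]; exists (fun w => mmode M v n (a w)) => //.
    by apply: mode_algebra_comp => //; apply: mode_algebra_mode.
- move=> S0; have : [set z | exists2 a, mode_algebra a & a x = z] x by exists id.
  by rewrite S0 /= => x1; rewrite x1 eqxx in x0.
- move=> S1; have : [set z | exists2 a, mode_algebra a & a x = z] y by rewrite S1.
  by [].
Qed.

Lemma mode_algebra_density (I : finType) (x y : I -> M) :
  respects_relations x y -> exists2 a, mode_algebra a & forall i, a (x i) = y i.
Proof.
apply: jacobson_density.
- exact: mode_algebra_linear.
- exact: mode_algebra_id.
- exact: mode_algebra_comb.
- exact: mode_algebra_comp.
- exact: mode_algebra_transitive.
- move=> T lT comT; apply: schur => // v n w.
  by apply: comT; apply: mode_algebra_mode.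
Qed.

Lemma mode_density (I : finType) (x y : I -> M) :
  respects_relations x y -> in_mode_span x y.
Proof.
move=> /mode_algebra_density[a Aa ax].
by apply: in_mode_span_ext ax _; apply: mode_algebra_span.
Qed.

Hypothesis sV : simple_voa V.

(** Vectors all of whose modes vanish on [M] form an ideal: for [m = 0] the right-hand side of the
    Jacobi identity is the single term [(u_l v)_n w]. This ideal omits the vacuum, so it is zero. *)
Lemma faithful_modes (t : V) : (forall n (w : M), mmode M t n w = 0) -> t = 0.
Proof.
have [_ [w0 w0n] _] := hM.
pose I : set V := [set t | forall n (w : M), mmode M t n w = 0].
have gb0 i : i != 0%N -> gbinom (ratr 0 : R[i]) i = 0.
  case: i => // i _; rewrite /gbinom (bigD1 ord0) //= rmorph0 subrr mul0r.
  by rewrite mul0r.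
have key u v l n w : (I u \/ I v) -> mmode M (vmode u l v) n w = 0.
  move=> uv; have := wmod_jacobi hMw u v w l 0 n.
  rewrite (_ : (0 \is a Num.int) = true); last exact: (natr_int _ 0).
  rewrite fsbig1; last first.
    by move=> i _; case: uv => [->|->]; rewrite ?linear0 ?scaler0.
  rewrite fsbig1; last first.
    by move=> i _; case: uv => [->|->]; rewrite ?linear0 ?scaler0.
  rewrite scaler0 subrr (@natsum_trunc _ _ 1).
    by rewrite big_ord1 /= gbinom0 scale1r addr0 add0r subr0 => <-.
  by move=> i i1; rewrite gb0 ?scale0r // -lt0n.
have [|I0|I1] := sV (I := I).
- split; first split.
  + by move=> n w; rewrite mmode0l.
  + by move=> a u v uI vI n w; rewrite mmodeDl // mmodeZl // uI vI scaler0 addr0.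
  + by move=> u v n uI; split => m w; apply: key; [right|left].
- by move=> tI; have : I t := tI; rewrite I0.
- have : I (vac V) by rewrite I1.
  move=> /(_ (-1) w0); rewrite (wmod_vacuum hMw) eqxx => w00.
  by rewrite w00 eqxx in w0n.
Qed.

(* The injectivity of v (x) w |-> Y(v,z)w on V (x) M: a family [l] respecting
   the linear relations of [w] is a functional on the span of [w]. *)
Lemma killed_relation (I : finType) (v : I -> V) (w : I -> M) (l : I -> R[i]^o) :
  killed v w -> respects_relations w l -> \sum_i l i *: v i = 0.
Proof.
move=> vw lw; apply: faithful_modes => n e.
(* Density replaces each [w i] by [l i *: e], turning the vanishing sum into the [n]-th mode of the
   sum of the [l i *: v i], applied to [e]. *)
have [|a Aa aE] := @mode_algebra_density _ w (fun i => (l i : R[i]) *: e).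
  move=> c /lw c0; rewrite -[RHS](scale0r e) -c0 scaler_suml.
  by apply: eq_bigr => i _; rewrite scalerA.
have := killed_algebra hV hMw Aa vw n.
under eq_bigr do rewrite aE.
rewrite mmode_suml // => vw0; rewrite -[RHS]vw0; apply: eq_bigr => i _.
by rewrite mmodeZl // linearZ.
Qed.

End IrreducibleModules.

(** * The projective action of G *)

Section Intertwiners.
Variables (R : realType) (V : vertex_data R) (gT : finGroupType).
Variables (G : aut_group V gT) (M : module_data V) (P : intertwiners G M).
Hypothesis hV : is_voa V.
Hypothesis hM : irreducible_module M.
Let hMw : is_weak_module M := let: And3 h _ _ := hM in mod_weak h.

Lemma autg1 v : G 1%g v = v.
Proof. by apply: (bij_inj (aut_bijective (autg_aut G 1%g))); rewrite -autg_mul mulg1. Qed.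

Lemma autgVK g v : G g (G g^-1%g v) = v.
Proof. by rewrite -autg_mul mulgV autg1. Qed.

Lemma phi_eq0 g w : P g w = 0 -> w = 0.
Proof. by move=> Pw; apply: (bij_inj (phi_bij P g)); rewrite Pw linear0. Qed.

(** Both sides intertwine the action of [V] with its twist by [gh], so Schur's lemma provides the
    scalar and [xget] does not fall back on 0. *)
Lemma cocycleP g h w : P g (P h w) = cocycle P g h *: P (g * h)%g w.
Proof.
rewrite /cocycle.
have ex : exists a : R[i], forall w, P g (P h w) = a *: P (g * h)%g w.
  apply: (schur_intertwiners hM (k := fun v => G g (G h v)) (T1 := P g \o P h)).
  - exact: phi_bij.
  - by move=> v n w1 /=; rewrite !phi_mode.
  - by move=> v n w1; rewrite phi_mode autg_mul.
exact: (xgetPex 0 ex w).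
Qed.

Lemma cocycle_neq0 g h : cocycle P g h != 0.
Proof.
have [_ [w w0] _] := hM; apply: contraNneq w0 => c0.
have := cocycleP g h w; rewrite c0 scale0r => /phi_eq0/phi_eq0 w1.
by rewrite w1.
Qed.

(** The inverse of [P g], written as a multiple of [P g^-1] so that linear independence passes from
    the [P g] to their inverses. *)
Definition phi_inv g w : M := (cocycle P g g^-1%g)^-1 *: P g^-1%g w.

Lemma phi_inv_linear g : linear (phi_inv g).
Proof. by move=> a u v; rewrite /phi_inv linearP scalerDr !scalerA mulrC. Qed.

Lemma phi_invZ g a w : phi_inv g (a *: w) = a *: phi_inv g w.
Proof. by rewrite /phi_inv linearZ /= !scalerA mulrC. Qed.

Lemma phi_invK g w : P g (phi_inv g w) = w.
Proof.
by rewrite linearZ /= cocycleP mulgV phi1 scalerA mulVf ?scale1r ?cocycle_neq0.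
Qed.

Lemma phiK g w : phi_inv g (P g w) = w.
Proof. by apply: (bij_inj (phi_bij P g)); rewrite phi_invK. Qed.

Lemma phi_inv_mode g v n w :
  phi_inv g (mmode M v n w) = mmode M (G g^-1%g v) n (phi_inv g w).
Proof.
by apply: (bij_inj (phi_bij P g)); rewrite phi_invK phi_mode autgVK phi_invK.
Qed.

Lemma phi_phi_inv g h w :
  P h (phi_inv (g * h)%g w) = cocycle P g h *: phi_inv g w.
Proof.
apply: (bij_inj (phi_bij P g)).
by rewrite cocycleP phi_invK linearZ /= phi_invK.
Qed.

(** Conjugation by [phi] leaves equivariant [f] and [f'] unchanged and moves each [v] to [G g v];
    the mean over [g] has fixed vectors. As [s'] depends on [s] alone, it can serve two modules [W]
    at once. *)
Lemma average_modes (s : seq (V * rat)) :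
  exists s' : seq (fixed_space G * rat),
  forall (W : tga_rep R gT) (f f' : W -> M),
    (forall g x, f (ract W (tga_bar R g) x) = P g (f x)) ->
    (forall g x, f' (ract W (tga_bar R g) x) = P g (f' x)) ->
    (forall x, f' x = mode_sum s (f x)) ->
    forall x, f' x = \sum_(p <- s') mmode M (val p.1) p.2 (f x).
Proof.
pose c : R[i] := #|gT|%:R^-1.
have avgP v : c *: (\sum_g G g v) \in fixed_pred G.
  apply/fixed_predP => h; rewrite linearZ linear_sum /=; congr (_ *: _).
  rewrite [RHS](reindex_inj (mulgI h)) /=.
  by apply: eq_bigr => g _; rewrite autg_mul.
exists [seq (FixedSpace (avgP p.1), p.2) | p <- s] => W f f' ef ef' ff' x.
have key g : f' x = \sum_(p <- s) mmode M (G g p.1) p.2 (f x).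
  rewrite -[f' x](phiK g^-1%g) -ef' ff' ef /mode_sum.
  rewrite -[phi_inv _ _]/(linear_of (phi_inv_linear g^-1%g) _) linear_sum /=.
  by apply: eq_bigr => p _; rewrite phi_inv_mode invgK phiK.
have cG : #|gT|%:R != 0 :> R[i] by rewrite pnatr_eq0 -lt0n; apply/card_gt0P; exists 1%g.
have -> : f' x = c *: \sum_(g : gT) f' x.
  by rewrite sumr_const -scaler_nat scalerA mulVf ?scale1r.
rewrite (eq_bigr _ (fun g _ => key g)) exchange_big /= big_map scaler_sumr.
by apply: eq_bigr => p _; rewrite mmodeZl // mmode_suml.
Qed.

Hypothesis sV : simple_voa V.

Lemma phi_free (c : gT -> R[i]) :
  (forall w, \sum_g c g *: P g w = 0) -> forall g, c g = 0.
Proof.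
have [n] := ubnP #|[pred g | c g != 0]|.
elim: n c => // n IHn c ltn c0 h; apply/eqP/negPn/negP => ch.
suff ch0 g : g != h -> c g = 0.
  have [_ [w w0] _] := hM.
  have := c0 w; rewrite (bigD1 h) //= big1 ?addr0.
    move/eqP; rewrite scaler_eq0 (negPf ch) /= => /eqP/phi_eq0 w1.
    by rewrite w1 eqxx in w0.
  by move=> g /ch0 ->; rewrite scale0r.
move=> gh; apply/eqP/negPn/negP => cg.
have [v vgh] : exists v, G g v != G h v.
  apply: contrapT => H; move/eqP: gh; apply; apply: (autg_inj (a := G)) => v.
  by apply/eqP/negPn/negP => vgh; apply: H; exists v.
(* These coefficients pick out [x g - x h], so the functional [l] obtained below takes distinct
   values at [G g v] and [G h v]. *)
pose d k : R[i] := (k == g)%:R - (k == h)%:R.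
have dE (E : lmodType R[i]) (x : gT -> E) : \sum_k d k *: x k = x g - x h.
  have pick h' : \sum_k (k == h')%:R *: x k = x h'.
    rewrite (bigD1 h') //= eqxx scale1r big1 ?addr0 // => k /negPf->.
    by rewrite scale0r.
  by under eq_bigr do rewrite scalerBl; rewrite sumrB !pick.
have [|l [lV]] := @separating_coordinates _ _ _ (fun k => G k v) d.
  by rewrite dE subr_eq0.
rewrite -[X in X != 0]/(\sum_k d k *: l k) dE subr_eq0 => lgh.
(* Otherwise a functional [m] on the span of the [P k w] detects the sum. But the relation applied
   to [v_q w] gives [kl], hence the sum of the [m k * c k *: G k v] is 0, and applying [l]
   contradicts the choice of [m]. *)
have cl0 w : \sum_k (c k * l k) *: P k w = 0.
  apply/eqP/negPn/negP => /separating_coordinates[m [mP]].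
  have kl : killed (fun k => c k *: G k v) (fun k => P k w).
    move=> q; under eq_bigr do rewrite mmodeZl // -phi_mode.
    exact: c0.
  have := killed_relation hV hM sV kl mP.
  under eq_bigr do rewrite scalerA.
  move=> /lV cm /negP; apply; apply/eqP; rewrite -[RHS]cm.
  by apply: eq_bigr => k _; rewrite -[RHS]/(m k * c k * l k); ring.
(* Subtracting [l h] times the original relation removes [h] from the support, so induction applies;
   the coefficient at [g] would stay nonzero. *)
suff /(_ g)/eqP : forall k, c k * (l k - l h) = 0.
  by rewrite mulf_eq0 (negPf cg) subr_eq0 (negPf lgh).
apply: IHn.
- apply: leq_trans (ltn : (_ <= n)%N); apply: proper_card; apply/properP; split.
    apply/fintype.subsetP => k; by rewrite !inE mulf_eq0 => /norP[].
  by exists h; rewrite !inE ?ch // subrr mulr0 eqxx.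
- move=> w; under eq_bigr do rewrite mulrBr scalerBl.
  rewrite sumrB cl0 sub0r; apply/eqP; rewrite oppr_eq0; apply/eqP.
  under eq_bigr do rewrite mulrC -scalerA.
  by rewrite -scaler_sumr c0 scaler0.
Qed.

Lemma phi_inv_free (c : gT -> R[i]) :
  (forall w, \sum_g c g *: phi_inv g w = 0) -> forall g, c g = 0.
Proof.
move=> c0 g.
have /(_ g^-1%g) : forall g, c g^-1%g / cocycle P g^-1%g g = 0.
  apply: phi_free => w; rewrite -[RHS](c0 w) [RHS](reindex_inj invg_inj) /=.
  by apply: eq_bigr => h _; rewrite /phi_inv invgK scalerA.
by rewrite invgK => /eqP; rewrite mulf_eq0 invr_eq0 (negPf (cocycle_neq0 _ _)) orbF => /eqP.
Qed.

(** * Averaging linear maps into equivariant ones *)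

Section TgaModule.
Variable W : tga_rep R gT.
Hypothesis hW : is_tga_module (cocycle P) W.
Local Notation rho g := (ract W (tga_bar R g)).

Lemma tga_bar_span (a : tga R gT) : a = \sum_g a g *: tga_bar R g.
Proof.
apply/ffunP => h; rewrite sum_ffunE (bigD1 h) //= big1 ?addr0.
  by rewrite !ffunE eqxx -[_ *: _]/(_ * _) mulr1.
by move=> g gh; rewrite !ffunE eq_sym (negPf gh) scaler0.
Qed.

Lemma ract_bar a x : ract W a x = \sum_g a g *: rho g x.
Proof.
have [lW _ _] := hW; rewrite {1}(tga_bar_span a).
rewrite -[ract W _]/(linear_of lW _) linear_sum sum_lfunE.
by apply: eq_bigr => g _; rewrite linearZ /= lfunE.
Qed.

Lemma rho1 x : rho 1%g x = x.
Proof. by have [_ -> _] := hW; rewrite lfunE. Qed.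

Lemma rhoM g h x : rho g (rho h x) = cocycle P g h *: rho (g * h)%g x.
Proof.
have [lW _ mW] := hW.
rewrite -[LHS](comp_lfunE (ract W (tga_bar R g))) -mW tga_mul_bar.
by rewrite -[ract W _]/(linear_of lW _) linearZ /= lfunE.
Qed.

Lemma equivariantP (f : W -> M) : linear f ->
  equivariant P f <-> forall g x, f (rho g x) = P g (f x).
Proof.
move=> lf; split=> [ef g x|ef a x].
  rewrite ef /tga_act (bigD1 g) //= ffunE eqxx scale1r big1 ?addr0 // => h.
  by move/negPf=> hg; rewrite ffunE hg scale0r.
rewrite ract_bar -[f _]/(linear_of lf _) linear_sum; apply: eq_bigr => g _.
by rewrite linearZ /= ef.
Qed.

Lemma hom_linear (f : hom_space P W) : linear (val f).
Proof. by have /asboolP[] := valP f. Qed.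

Lemma hom_rho (f : hom_space P W) g x : val f (rho g x) = P g (val f x).
Proof. by have /asboolP[lf /(equivariantP lf)] := valP f; apply. Qed.

(** Not divided by the order of the group: an equivariant map is multiplied by [#|gT|]. *)
Definition average (f : W -> M) (x : W) : M := \sum_g phi_inv g (f (rho g x)).

(** After reindexing by [g |-> g h], the scalar [cocycle P g h] appears on both sides, from
    [phi_phi_inv] and from [rhoM]. *)
Lemma average_hom (f : W -> M) : linear f -> average f \in hom_pred P (W := W).
Proof.
move=> lf.
have la : linear (average f).
  move=> a x y; rewrite /average scaler_sumr -big_split /=; apply: eq_bigr => g _.
  by rewrite linearP lf phi_inv_linear.
apply/asboolP; split=> //; apply/equivariantP => // h x.
rewrite /average linear_sum /= [RHS](reindex_inj (mulIg h)) /=.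
apply: eq_bigr => g _; rewrite phi_phi_inv rhoM.
rewrite -[f _]/(linear_of lf _) linearZ /=.
by rewrite phi_invZ.
Qed.

Lemma average_id (f : hom_space P W) x : average (val f) x = #|gT|%:R *: val f x.
Proof.
rewrite /average (eq_bigr (fun _ => val f x)) => [|g _].
  by rewrite sumr_const -scaler_nat.
by rewrite hom_rho phiK.
Qed.

End TgaModule.
End Intertwiners.

(** * Equivariant maps from simple modules of the twisted group algebra *)

Section SimpleTgaModules.
Variables (R : realType) (V : vertex_data R) (gT : finGroupType).
Variables (G : aut_group V gT) (M : module_data V) (P : intertwiners G M).
Hypothesis hV : is_voa V.
Hypothesis hM : irreducible_module M.
Hypothesis sV : simple_voa V.

Lemma hom_eq (W : tga_rep R gT) (f f' : hom_space P W) :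
  (forall x, val f x = val f' x) -> f = f'.
Proof. by move=> ff'; apply: val_inj; apply: funext. Qed.

Lemma hom_ract (W : tga_rep R gT) (f : hom_space P W) a x :
  val f (ract W a x) = tga_act P a (val f x).
Proof. by have /asboolP[_ ->] := valP f. Qed.

Definition hom_map (W : tga_rep R gT) (f : hom_space P W) : {linear W -> M} :=
  linear_of (hom_linear f).

Lemma hom_basis (W : tga_rep R gT) (f : hom_space P W) x :
  val f x = \sum_i coord (vbasis {:W}) i x *: val f (vbasis {:W})`_i.
Proof.
rewrite {1}(coord_vbasis (memvf x)) -[val f]/(hom_map f : W -> M) linear_sum.
by apply: eq_bigr => i _; rewrite linearZ.
Qed.

Lemma simple_tga_nonzero (W : tga_rep R gT) :
  simple_tga_module (cocycle P) W -> exists x : W, x != 0.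
Proof.
move=> [_ W0 _]; exists (vpick {:W}).
by rewrite vpick0.
Qed.

Lemma simple_tga_cyclic (W : tga_rep R gT) : simple_tga_module (cocycle P) W ->
  forall x y : W, x != 0 -> exists a, y = ract W a x.
Proof.
move=> [[lW W1 mW] W0 simW] x y x0.
have lx : linear (fun a => ract W a x).
  by move=> c a b; rewrite lW add_lfunE scale_lfunE.
pose h : 'Hom(tga R gT, W) := linfun (linear_of lx).
have hE a : h a = ract W a x by rewrite lfunE.
have [|U0|U1] := simW (limg h).
- move=> b; apply/subvP => _ /memv_imgP[_ /memv_imgP[a _ ->] ->].
  by rewrite hE -comp_lfunE -mW -hE memv_img ?memvf.
- have : h (tga_bar R 1%g) \in limg h by rewrite memv_img ?memvf.
  by rewrite U0 memv0 hE W1 lfunE /= (negPf x0).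
- have : y \in limg h by rewrite U1 memvf.
  by move=> /memv_imgP[a _ ->]; exists a; rewrite hE.
Qed.

(** A nonzero vector of the kernel would generate all of [W], making [f] zero. *)
Lemma hom_injective (W : tga_rep R gT) (f : hom_space P W) :
  simple_tga_module (cocycle P) W -> f != 0 -> injective (val f).
Proof.
move=> sW f0 x y fxy; apply/eqP; rewrite -subr_eq0; apply/negPn/negP => xy0.
case/eqP: f0; apply: hom_eq => z.
have [a ->] := simple_tga_cyclic sW z xy0.
rewrite hom_ract -[val f]/(hom_map f : W -> M) linearB /=.
have -> : val f x - val f y = 0 by rewrite fxy subrr.
by rewrite /tga_act big1 // => g _; rewrite linear0 scaler0.
Qed.

(* If the averages of all rank-one maps y |-> xi(y) m vanished, the independence
   of the operators phi(g)^-1 would give xi(g x) = 0, in particular xi(x) = 0. *)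
Lemma exists_hom (W : tga_rep R gT) :
  simple_tga_module (cocycle P) W -> exists f : hom_space P W, f != 0.
Proof.
move=> sW; have [tW _ _] := sW; have [x x0] := simple_tga_nonzero sW.
have [i xi] : exists i, coord (vbasis {:W}) i x != 0.
  apply: contrapT => H; move/eqP: x0; apply.
  rewrite (coord_vbasis (memvf x)) big1 // => i _.
  apply/eqP; rewrite scaler_eq0; apply/orP; left.
  by apply/negPn/negP => xi; apply: H; exists i.
apply: contrapT => noh; case/eqP: xi.
have lf m : linear (fun y : W => coord (vbasis {:W}) i y *: m : M).
  by move=> a y z; rewrite linearP scalerDl scalerA.
(* The goal becomes the vanishing at [g = 1] of the coefficients [c] of a relation between the
   [phi_inv g]. *)
rewrite -[x](rho1 tW).
pose c g := coord (vbasis {:W}) i (ract W (tga_bar R g) x).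
apply: (phi_inv_free hV hM sV (P := P) (c := c)) => m.
pose f := HomSpace (average_hom hM tW (lf m)).
have /(congr1 (fun f : hom_space P W => val f x)) /= : f = 0.
  by apply/eqP/negPn/negP => f0; apply: noh; exists f.
rewrite /average => E; rewrite -[RHS]E; apply: eq_bigr => g _.
by rewrite phi_invZ.
Qed.

Lemma isotypic_component_nonzero (W : tga_rep R gT) :
  simple_tga_module (cocycle P) W ->
  exists2 w : M, isotypic_component P W w & w != 0.
Proof.
move=> sW; have [f f0] := exists_hom sW; have [x x0] := simple_tga_nonzero sW.
have injf := hom_injective sW f0.
exists (val f x); last first.
  apply: contraNneq x0 => fx; apply/eqP/injf.
  by rewrite fx -[val f]/(hom_map f : W -> M) linear0.
exists 1%N, (fun=> val f x); split; last by rewrite big_ord1.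
move=> _; exists (range (val f)); last by exists x.
exists (hom_map f); split=> // a y; exact: hom_ract.
Qed.

Lemma mode_sum_linear s : linear (mode_sum s : M -> M).
Proof.
move=> a x y; rewrite /mode_sum scaler_sumr -big_split /=.
by apply: eq_bigr => p _; rewrite linearP.
Qed.

Definition mode_sum_map s : {linear M -> M} := linear_of (mode_sum_linear s).

Lemma mode_sum_hom (W : tga_rep R gT) (f f' : hom_space P W) s :
  (forall i : 'I_(\dim {:W}),
     val f' (vbasis {:W})`_i = mode_sum s (val f (vbasis {:W})`_i)) ->
  forall x, val f' x = mode_sum s (val f x).
Proof.
move=> sP x; rewrite hom_basis [val f x]hom_basis -[mode_sum s]/(mode_sum_map s : M -> M).
by rewrite linear_sum; apply: eq_bigr => i _; rewrite linearZ /= sP.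
Qed.

Lemma hom_sumE (W : tga_rep R gT) (I : Type) (r : seq I) (F : I -> hom_space P W) x :
  val (\sum_(i <- r) F i) x = \sum_(i <- r) val (F i) x.
Proof. exact: (big_morph (fun f : hom_space P W => val f x)). Qed.

Lemma hom_combination (W : tga_rep R gT) (f : hom_space P W) (c : 'I_(\dim {:W}) -> R[i]) :
  \sum_i c i *: val f (vbasis {:W})`_i = val f (\sum_i c i *: (vbasis {:W})`_i).
Proof.
rewrite -[val f]/(hom_map f : W -> M) linear_sum.
by apply: eq_bigr => i _; rewrite linearZ.
Qed.

(** As [f] is injective, sending [f] of a basis to [f'] of that basis respects relations; density
    realizes this by modes of [V], and averaging by modes of the fixed points. *)
Lemma fixed_mode_transitive (W : tga_rep R gT) (f f' : hom_space P W) :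
  simple_tga_module (cocycle P) W -> f != 0 ->
  exists s : seq (fixed_voa G * rat),
    f' = \sum_(p <- s) mmode (multiplicity_space P W) p.1 p.2 f.
Proof.
move=> sW f0; have [tW _ _] := sW; have injf := hom_injective sW f0.
pose b i := (vbasis {:W})`_(i : 'I_(\dim {:W})).
have [|s sP] := @mode_density _ _ _ hV hM _ (fun i => val f (b i)) (fun i => val f' (b i)).
  move=> c; rewrite !hom_combination => fc.
  rewrite (_ : \sum_i _ = 0) -1?[val f']/(hom_map f' : W -> M) ?linear0 //.
  by apply: injf; rewrite fc -[val f]/(hom_map f : W -> M) linear0.
have [s' s'P] := average_modes P hM s.
exists s'; apply: hom_eq => x; rewrite hom_sumE.
by apply: s'P; [exact: hom_rho|exact: hom_rho|exact: mode_sum_hom].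
Qed.

(** The images of [f] and [f'] meet only in 0, so the identity on the first and zero on the second
    together respect relations; density and averaging apply as before. *)
Lemma fixed_mode_separate (W W' : tga_rep R gT)
    (f : hom_space P W) (f' : hom_space P W') :
  is_tga_module (cocycle P) W -> is_tga_module (cocycle P) W' ->
  (forall x x', val f x = val f' x' -> val f x = 0) ->
  exists s : seq (fixed_voa G * rat),
    f = \sum_(p <- s) mmode (multiplicity_space P W) p.1 p.2 f /\
    0 = \sum_(p <- s) mmode (multiplicity_space P W') p.1 p.2 f'.
Proof.
move=> tW tW' ff'.
pose b i := (vbasis {:W})`_(i : 'I_(\dim {:W})).
pose b' i := (vbasis {:W'})`_(i : 'I_(\dim {:W'})).
have [|s sP] := @mode_density _ _ _ hV hM _
  (fun i => match i with inl j => val f (b j) | inr j => val f' (b' j) end)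
  (fun i => match i with inl j => val f (b j) | inr _ => 0 end).
  move=> c; rewrite !big_sumType /= [X in _ -> _ + X = _]big1 ?addr0; last first.
    by move=> i _; rewrite scaler0.
  rewrite (hom_combination f (fun i => c (inl i))).
  rewrite (hom_combination f' (fun i => c (inr i))) => /eqP.
  rewrite addr_eq0 => /eqP fc; apply: (ff' _ (- \sum_i c (inr i) *: b' i)).
  by rewrite fc -[val f']/(hom_map f' : W' -> M) linearN.
have [s' s'P] := average_modes P hM s.
exists s'; split; apply: hom_eq => x; rewrite hom_sumE; apply: s'P.
- exact: hom_rho.
- exact: hom_rho.
- by apply: mode_sum_hom => i; rewrite -(sP (inl i)).
- exact: hom_rho.
- exact: hom_rho.
- by apply: mode_sum_hom => i; rewrite -(sP (inr i)).
Qed.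

Lemma image_sub (W W' : tga_rep R gT) (f : hom_space P W) (f' : hom_space P W') x x' :
  simple_tga_module (cocycle P) W -> x != 0 -> val f x = val f' x' ->
  forall y, exists y', val f y = val f' y'.
Proof.
move=> sW x0 fx y; have [a ->] := simple_tga_cyclic sW y x0.
by exists (ract W' a x'); rewrite !hom_ract fx.
Qed.

(** A common nonzero vector generates both images, so they coincide. The two injections then give
    inverse maps [T] and [U] commuting with the action, and cyclicity of the trace concludes. *)
Lemma character_eq (W W' : tga_rep R gT) (f : hom_space P W) (f' : hom_space P W') x x' :
  simple_tga_module (cocycle P) W -> simple_tga_module (cocycle P) W' ->
  val f x != 0 -> val f x = val f' x' -> character W = character W'.
Proof.
move=> sW sW' fx0 fx.
have hom0 (U : tga_rep R gT) (h : hom_space P U) : val h 0 = 0.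
  by rewrite -[val h]/(hom_map h : U -> M) linear0.
have f0 : f != 0 by apply: contraNneq fx0 => ->.
have f0' : f' != 0 by apply: contraNneq fx0 => f0'; rewrite fx f0'.
have x0 : x != 0 by apply: contraNneq fx0 => ->; rewrite hom0.
have x0' : x' != 0 by apply: contraNneq fx0 => x0'; rewrite fx x0' hom0.
have injf := hom_injective sW f0; have injf' := hom_injective sW' f0'.
have /choice[t tP] := image_sub sW x0 fx.
have /choice[u uP] := image_sub sW' x0' (esym fx).
have lt : linear t.
  move=> a y z; apply: injf'; rewrite -tP (hom_linear f) (hom_linear f').
  by rewrite -!tP.
have lu : linear u.
  move=> a y z; apply: injf; rewrite -uP (hom_linear f) (hom_linear f').
  by rewrite -!uP.
pose T : 'Hom(W, W') := linfun (linear_of lt).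
pose U : 'Hom(W', W) := linfun (linear_of lu).
apply: funext => a.
have UT : (U \o T = \1)%VF.
  apply/lfunP => y; rewrite comp_lfunE !lfunE /=; apply: injf.
  by rewrite -uP -tP.
have aE : ract W' a = (T \o (ract W a \o U))%VF.
  apply/lfunP => y; rewrite !comp_lfunE !lfunE /=; apply: injf'.
  by rewrite -tP !hom_ract -uP.
have bW := vbasisP {:W}; have bW' := vbasisP {:W'}.
rewrite /character aE (passmx.mxof_comp _ _ bW) (passmx.mxof_comp _ _ bW).
rewrite mxtrace_mulC mulmxA -(passmx.mxof_comp _ _ bW') UT.
by rewrite passmx.mxof1 ?mul1mx // (basis_free bW).
Qed.

End SimpleTgaModules.

(** * The multiplicity spaces as modules *)

Lemma finite_dim_fintype (R : realType) (E : lmodType R[i]) (S : set E) (I : finType)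
    (b : I -> E) : (forall i, S (b i)) ->
  (forall v, S v -> exists c : I -> R[i], v = \sum_i c i *: b i) -> finite_dim S.
Proof.
move=> Sb Sspan; exists #|I|, (fun i => b (enum_val i)); split=> // v /Sspan[c ->].
exists (fun i => c (enum_val i)).
by rewrite -(big_enum_val (A := predT) (fun i => c i *: b i)).
Qed.

Lemma fsum_seq (E : nmodType) (I : choiceType) (F : I -> E) (s : seq I) :
  (forall i, i \notin s -> F i = 0) ->
  \sum_(i \in [set: I]) F i = \sum_(i <- undup s) F i.
Proof.
move=> F0; rewrite (@fsbigE _ _ _ _ _ (undup s)) ?undup_uniq //.
  by apply: eq_bigl => i; rewrite in_setT.
by move=> i _; rewrite mem_undup; apply: F0.
Qed.

Section FiniteSupport.
Variables (R : pzRingType) (E : lmodType R) (I : choiceType).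
Implicit Types (F : I -> E) (s : seq I).

Lemma linear_fsum (E' : lmodType R) (L : {linear E -> E'}) F s :
  (forall i, i \notin s -> F i = 0) ->
  L (\sum_(i \in [set: I]) F i) = \sum_(i \in [set: I]) L (F i).
Proof.
move=> F0; rewrite (fsum_seq F0) (fsum_seq (F := fun i => L (F i)) (s := s)) ?linear_sum //.
by move=> i /F0 ->; rewrite linear0.
Qed.

Lemma fsumP a F F' s : (forall i, i \notin s -> F i = 0) ->
  (forall i, i \notin s -> F' i = 0) ->
  \sum_(i \in [set: I]) (a *: F i + F' i) =
  a *: \sum_(i \in [set: I]) F i + \sum_(i \in [set: I]) F' i.
Proof.
move=> F0 F0'; rewrite (fsum_seq F0) (fsum_seq F0').
rewrite (fsum_seq (F := fun i => a *: F i + F' i) (s := s)); last first.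
  by move=> i si; rewrite F0 // F0' // scaler0 addr0.
by rewrite big_split scaler_sumr.
Qed.

End FiniteSupport.

Section MultiplicityModule.
Variables (R : realType) (V : vertex_data R) (gT : finGroupType).
Variables (G : aut_group V gT) (M : module_data V) (P : intertwiners G M).
Hypothesis hV : is_voa V.
Hypothesis hM : irreducible_module M.
Let hMm : is_module M := let: And3 h _ _ := hM in h.
Let hMw : is_weak_module M := mod_weak hMm.
Variable W : tga_rep R gT.
Hypothesis tW : is_tga_module (cocycle P) W.
Local Notation MW := (multiplicity_space P W).
Local Notation b i := ((vbasis {:W})`_i).

Lemma hom_modeE v n (f : MW) x : val (mmode MW v n f) x = mmode M (val v) n (val f x).
Proof. by []. Qed.

Lemma hom_eval_linear x : linear (fun f : hom_space P W => val f x).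
Proof. by []. Qed.

Definition hom_eval x : {linear hom_space P W -> M} := linear_of (hom_eval_linear x).

Lemma hom_eq0 (f : hom_space P W) :
  (forall i : 'I_(\dim {:W}), val f (b i) = 0) -> f = 0.
Proof.
by move=> f0; apply: hom_eq => x; rewrite hom_basis big1 // => i _; rewrite f0 scaler0.
Qed.

(** A bound valid on a basis of the finite-dimensional [W] is uniform in the argument of [f]. *)
Lemma multiplicity_trunc (u : fixed_voa G) (f : MW) :
  exists K : nat, forall n : rat, K%:R <= n -> mmode MW u n f = 0.
Proof.
have [K KP] := mmode_trunc hMw (fun _ : 'I_1 => val u) (fun i : 'I_(\dim {:W}) => val f (b i)).
by exists K => n le_n; apply: hom_eq0 => i; apply: (KP ord0).
Qed.

Lemma natsum_hom (F : nat -> hom_space P W) N x : (forall i, (N <= i)%N -> F i = 0) ->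
  val (\sum_(i \in [set: nat]) F i) x = \sum_(i \in [set: nat]) val (F i) x.
Proof.
move=> F0; apply: (linear_fsum (hom_eval x) (s := iota 0 N)) => i.
by rewrite mem_iota add0n -leqNgt; apply: F0.
Qed.

Lemma multiplicity_weak_module : is_weak_module MW.
Proof.
split.
- move=> n f a u v; apply: hom_eq => x.
  exact: (wmod_linear hMw n (val f x) a (val u) (val v)).
- move=> u f; have [K KP] := multiplicity_trunc u f.
  by exists K%:R.
- move=> n f; apply: hom_eq => x; rewrite hom_modeE (wmod_vacuum hMw).
  by case: ifP.
move=> u v f l m n; apply: hom_eq => x.
(* Evaluation at [x] passes through a sum of maps of finite support, so bounds are needed for the
   maps themselves and not only for their values at [x]. *)
have [K KP] := multiplicity_trunc u f; have [L LP] := multiplicity_trunc v f.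
have [k kP] := exists_shift K m; have [j jP] := exists_shift L n.
have [t tP] := vmode_trunc hV (fun _ : 'I_1 => val u) (fun _ => val v).
pose T := (t + `|l|)%N.
have S1 i : (j <= i)%N -> mmode MW v (n + i%:R) f = 0.
  by move=> ji; apply/LP/(le_trans jP); rewrite lerD2l ler_nat.
have S2 i : (k <= i)%N -> mmode MW u (m + i%:R) f = 0.
  by move=> ki; apply/KP/(le_trans kP); rewrite lerD2l ler_nat.
have S3 i : (T <= i)%N -> vmode u (l + i%:Z) v = 0.
  by move=> Ti; apply: val_inj; apply: (tP ord0); rewrite /T in Ti; lia.
have SE (h h' : hom_space P W) a : val (h - a *: h') x = val h x - a *: val h' x by [].
rewrite SE (@natsum_hom _ j) => [|i /S1 ->]; last by rewrite linear0 scaler0.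
rewrite (@natsum_hom _ k) => [|i /S2 ->]; last by rewrite linear0 scaler0.
have := wmod_jacobi hMw (val u) (val v) (val f x) l m n.
case: ifP => _ ->; last by [].
rewrite (@natsum_hom _ T) // => i /S3 ->.
by apply: hom_eq => y; rewrite -[LHS]/(_ *: mmode M 0 _ (val f y)) mmode0l // scaler0.
Qed.

Lemma weight_hom a (f : hom_space P W) :
  @weight_space R (fixed_voa G) MW a f <-> forall x, @weight_space R V M a (val f x).
Proof.
split=> [fa x|fa]; last by apply: hom_eq => x; exact: (fa x).
exact: (congr1 (fun h : hom_space P W => val h x) fa).
Qed.

Lemma weight_phi_inv a g w : @weight_space R V M a w -> @weight_space R V M a (phi_inv P g w).
Proof.
rewrite /weight_space /eigspace /= => wa.
by rewrite -(phi_invZ P g) -wa phi_inv_mode // (aut_conf (autg_aut G _)).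
Qed.

Lemma weight_phi a g w : @weight_space R V M a w -> @weight_space R V M a (P g w).
Proof.
rewrite /weight_space /eigspace /= => wa.
by rewrite -linearZ -wa phi_mode (aut_conf (autg_aut G _)).
Qed.

Lemma weight_comb a c u v : @weight_space R V M a u -> @weight_space R V M a v ->
  @weight_space R V M a (c *: u + v).
Proof.
rewrite /weight_space /eigspace /= => ua va.
by rewrite linearP ua va scalerDr !scalerA mulrC.
Qed.

Lemma weight0 a : @weight_space R V M a 0.
Proof. by rewrite /weight_space /eigspace /= linear0 scaler0. Qed.

Lemma weight_sum (I : finType) a (F : I -> M) :
  (forall i, @weight_space R V M a (F i)) -> @weight_space R V M a (\sum_i F i).
Proof.
move=> Fa; elim/big_ind: _ => // [|u v ua va]; first exact: weight0.
by have := weight_comb 1 ua va; rewrite scale1r.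
Qed.

Lemma weight_components : exists wc : M -> R[i] -> M,
  [/\ forall w a, @weight_space R V M a (wc w a),
      forall w, exists s : seq R[i], forall a, a \notin s -> wc w a = 0,
      forall w, w = \sum_(a \in [set: R[i]]) wc w a
    & forall w (x : R[i] -> M) (s : seq R[i]), (forall a, @weight_space R V M a (x a)) ->
        (forall a, a \notin s -> x a = 0) -> w = \sum_(a \in [set: R[i]]) x a ->
        wc w = x].
Proof.
have /choice[wc wcP] := mod_grading hMm.
exists wc; split=> [w|w|w|w x s xa xs wx]; have [[ws wf wE] wu] := wcP w => //.
  have [s sE] := (finite_seqP _).1 wf; exists s => a sa.
  apply/eqP/negPn/negP => wa; move/negP: sa; apply.
  by have : [set` s] a by rewrite -sE.
apply: wu; split=> //; apply: sub_finite_set (finite_seq s) => a /= xa0.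
by apply/negPn/negP => /xs xa1; rewrite xa1 eqxx in xa0.
Qed.

Lemma multiplicity_grading : direct_sum_decomposition (@weight_space R (fixed_voa G) MW).
Proof.
have [wc [wcw wcs wcE wcu]] := weight_components => f.
have wcP c u v : wc (c *: u + v) = (fun a => c *: wc u a + wc v a).
  have [s sP] := wcs u; have [t tP] := wcs v.
  have sP' a : a \notin s ++ t -> wc u a = 0 by rewrite mem_cat => /norP[/sP].
  have tP' a : a \notin s ++ t -> wc v a = 0 by rewrite mem_cat => /norP[_ /tP].
  apply: (wcu _ _ (s ++ t)) => [a|a ast|]; first exact: weight_comb.
    by rewrite sP' // tP' // scaler0 addr0.
  by rewrite (fsumP c sP' tP') -!wcE.
have wc_phi g w : wc (P g w) = (fun a => P g (wc w a)).
  have [s sP] := wcs w; apply: (wcu _ _ s) => [a|a /sP ->|].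
  - exact: weight_phi.
  - by rewrite linear0.
  - by rewrite -(linear_fsum (P g) sP) -wcE.
have hc_hom a : (fun x => wc (val f x) a) \in hom_pred P (W := W).
  have lh : linear (fun x => wc (val f x) a).
    by move=> c x y; rewrite (hom_linear f) wcP.
  apply/asboolP; split=> //; apply/equivariantP => // g x.
  by rewrite (hom_rho tW) wc_phi.
pose hc a := HomSpace (hc_hom a).
have /choice[s sP] : forall i : 'I_(\dim {:W}), exists s : seq R[i],
    forall a, a \notin s -> wc (val f (b i)) a = 0 by move=> i; apply: wcs.
(* Components of [f] outside the weights met on a basis of [W] vanish on that basis, hence are
   zero. *)
pose t := flatten [seq s i | i <- enum 'I_(\dim {:W})].
have hc0 a : a \notin t -> hc a = 0.
  move=> ta; apply: hom_eq0 => i; apply: sP; apply: contra ta => sia.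
  by apply/flatten_mapP; exists i; rewrite ?mem_enum.
exists hc; split.
  split=> [a||].
  - by apply/weight_hom => x; apply: wcw.
  - apply: sub_finite_set (finite_seq t) => a /= ha.
    by apply/negPn/negP => /hc0 ha1; rewrite ha1 eqxx in ha.
  - apply: hom_eq => x; rewrite -[RHS]/(hom_eval x _) (linear_fsum _ hc0).
    exact: wcE.
move=> y [yw yf yE]; apply: funext => a; apply: hom_eq => x.
have [r rE] := (finite_seqP _).1 yf.
have yr c : c \notin r -> y c = 0.
  move=> rc; apply/eqP/negPn/negP => yc; move/negP: rc; apply.
  by have : [set` r] c by rewrite -rE.
rewrite -[LHS]/(wc (val f x) a) (wcu _ (fun c => val (y c) x) r) //.
- by move=> c; exact: (weight_hom _ _).1 (yw c) x.
- by move=> c /yr ->.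
by rewrite {1}yE -[LHS]/(hom_eval x _) (linear_fsum _ yr).
Qed.

(** The averages [E] of the rank-one maps from coordinates of [W] to spanning vectors of the weight
    space suffice: [f] is a combination of these maps and equals its own normalized average. *)
Lemma multiplicity_finite_dim a : finite_dim (@weight_space R (fixed_voa G) MW a).
Proof.
have [n [e [ea espan]]] := mod_finite_dim hMm a.
have le (ji : 'I_(\dim {:W}) * 'I_n) :
    linear (fun x : W => coord (vbasis {:W}) ji.1 x *: e ji.2).
  by move=> c x y; rewrite linearP scalerDl scalerA.
pose E ji := HomSpace (average_hom hM tW (le ji)).
apply: (@finite_dim_fintype _ _ _ _ E) => [ji|f /weight_hom fa].
  apply/weight_hom => x; apply: weight_sum => g; apply: weight_phi_inv.
  by rewrite -[_ *: _]addr0; apply: weight_comb => //; apply: weight0.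
have /choice[c cP] : forall j : 'I_(\dim {:W}), exists c : 'I_n -> R[i],
    val f (b j) = \sum_i c i *: e i by move=> j; apply/espan/fa.
have cG : #|gT|%:R != 0 :> R[i] by rewrite pnatr_eq0 -lt0n; apply/card_gt0P; exists 1%g.
exists (fun ji => #|gT|%:R^-1 * c ji.1 ji.2); apply: hom_eq => x.
have -> : val f x = #|gT|%:R^-1 *: average P (val f) x.
  by rewrite (average_id hM tW) scalerA mulVf ?scale1r.
rewrite hom_sumE.
under eq_bigr do rewrite -scalerA.
under [RHS]eq_bigr do rewrite -[val _ x]/(_ *: (_ *: average P _ x)).
rewrite -scaler_sumr; congr (_ *: _).
rewrite /average; under [RHS]eq_bigr do rewrite scaler_sumr.
rewrite exchange_big; apply: eq_bigr => g _ /=.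
under [RHS]eq_bigr do rewrite -phi_invZ.
rewrite -[phi_inv P g]/(linear_of (phi_inv_linear P g) : M -> M) -linear_sum /=.
congr phi_inv; rewrite hom_basis.
rewrite -(pair_bigA _ (fun j i =>
  c j i *: (coord (vbasis {:W}) j (ract W (tga_bar R g) x) *: e i))) /=.
apply: eq_bigr => j _; rewrite cP scaler_sumr; apply: eq_bigr => i _.
by rewrite !scalerA mulrC.
Qed.

Lemma multiplicity_module : is_module MW.
Proof.
split.
- exact: multiplicity_weak_module.
- exact: multiplicity_grading.
- exact: multiplicity_finite_dim.
move=> a; have [N NP] := mod_bounded_below hMm a.
exists N => n nN; apply/seteqP; split => f /=.
  move=> /weight_hom fa; apply: hom_eq => x.
  by have := fa x; rewrite NP.
by move=> ->; apply/weight_hom => x; apply: weight0.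
Qed.

End MultiplicityModule.

(** * Irreducibility and inequivalence of the multiplicity spaces *)

Lemma multiplicity_irreducible (R : realType) (V : vertex_data R) (gT : finGroupType)
    (G : aut_group V gT) (M : module_data V) (P : intertwiners G M) (W : tga_rep R gT) :
  is_voa V -> simple_voa V -> irreducible_module M ->
  simple_tga_module (cocycle P) W -> irreducible_module (multiplicity_space P W).
Proof.
move=> hV sV hM sW; have [tW _ _] := sW; split.
- exact: multiplicity_module.
- exact: exists_hom.
move=> S [[S0 SP] Smode].
have [[f Sf f0]|noS] := pselect (exists2 f, S f & f != 0).
  right; apply/seteqP; split=> // f' _.
  have [s ->] := fixed_mode_transitive hV hM f' sW f0.
  elim/big_ind: _ => // [u v Su Sv|p _]; last exact: Smode.
  by rewrite -[u]scale1r; apply: SP.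
left; apply/seteqP; split=> f /= => [Sf|->//].
by apply/eqP/negPn/negP => f0; apply: noS; exists f.
Qed.

(** If the images of [f] and [F f] share a nonzero vector, the characters agree. Otherwise some sum
    of modes fixes [f] and kills [F f]; since [F] commutes with it, [F f = 0], against
    injectivity. *)
Lemma multiplicity_inequivalent (R : realType) (V : vertex_data R) (gT : finGroupType)
    (G : aut_group V gT) (M : module_data V) (P : intertwiners G M) (W W' : tga_rep R gT) :
  is_voa V -> simple_voa V -> irreducible_module M ->
  simple_tga_module (cocycle P) W -> simple_tga_module (cocycle P) W' ->
  equivalent_modules (multiplicity_space P W) (multiplicity_space P W') ->
  character W = character W'.
Proof.
move=> hV sV hM sW sW' [F [bijF Fmode]].
have [f f0] := exists_hom hV hM sV sW.
have [[x [x' [fx fx0]]]|noxx'] :=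
    pselect (exists x x', val f x = val (F f) x' /\ val f x != 0).
  exact: character_eq fx0 fx.
have [[tW _ _] [tW' _ _]] := (sW, sW').
have [x x' fx|s [fE F0]] := fixed_mode_separate hV hM (f := f) (f' := F f) tW tW'.
  by apply/eqP/negPn/negP => fx0; apply: noxx'; exists x, x'.
case/eqP: f0; apply: (bij_inj bijF); rewrite linear0 [RHS]F0 {1}fE linear_sum.
by apply: eq_bigr => p _; apply: Fmode.
Qed.

Theorem theorem5p4 (R : realType) (V : vertex_data R) (gT : finGroupType)
    (G : aut_group V gT) (M : module_data V) (phi : intertwiners G M)
    (W : (tga R gT -> R[i]) -> tga_rep R gT) :
  is_voa V ->
  simple_voa V ->
  irreducible_module M ->
  G_stable G M ->
  (forall lambda, irreducible_characters (cocycle phi) lambda ->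
     simple_tga_module (cocycle phi) (W lambda) /\
     character (W lambda) = lambda) ->
  [/\ forall lambda, irreducible_characters (cocycle phi) lambda ->
        exists2 w : M, isotypic_component phi (W lambda) w & w != 0,
      forall lambda, irreducible_characters (cocycle phi) lambda ->
        irreducible_module (multiplicity_space phi (W lambda))
    & forall lambda gamma,
        irreducible_characters (cocycle phi) lambda ->
        irreducible_characters (cocycle phi) gamma ->
        (equivalent_modules (multiplicity_space phi (W lambda))
           (multiplicity_space phi (W gamma)) <-> lambda = gamma)].
Proof.
move=> hV sV hM _ hW; split=> [l /hW[sW _]|l /hW[sW _]|l m hl hm].
- exact: isotypic_component_nonzero.
- exact: multiplicity_irreducible.
have [[sW cW] [sW' cW']] := (hW l hl, hW m hm); split=> [eqM|->].
  by rewrite -cW -cW'; apply: multiplicity_inequivalent eqM.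
by exists idfun; split=> //; exists idfun.
Qed.
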